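(* Let $\Phi^0$ be a homogeneous Poisson point process on $\mathbb{R}^d$. Almost surely the $\mathrm{CHN}^2$ construction is well defined at every level $n\in\mathbb{N}$. For each $n$, under the Palm probability of $\Phi^0$, every connected component of the $f^n$-graph $[G^n,0]$ is of class $\mathcal{F/F}$: it is finite and contains exactly one cycle, which has length $2$.
   Context: Standing assumptions: $\Phi^0$ is a simple point process on $\mathbb{R}^d$ with a.s. pairwise distinct interpoint distances (no ties). For finite sets $S,T\subset\mathbb{R}^d$ let $\delta(S,T)=\min_{x\in S,y\in T}\|x-y\|$. Graph of a point-shift $h$: vertices the points, directed edges $x\to h(x)$. $\mathrm{CHN}^2$ construction. $f^0(x)$ is the Euclidean nearest neighbour of $x$ in $\Phi^0$. Inductively, suppose $f^{k-1}$ is defined and every connected component of its graph is finite and contains exactly one cycle, which has length $2$, i.e. a pair $\{a,b\}$ with $f^{k-1}(a)=b$ and $f^{k-1}(b)=a$. These pairs are denoted $S^{k-1}_i$; their points are the cluster heads of order $k-1$, forming $\Phi^{k-1}_c$. For each pair $S^{k-1}_i$, let $S^{k-1}_j$ ($j\neq i$) be the pair minimizing $\delta(S^{k-1}_i,S^{k-1}_j)$, and let $x_i\in S^{k-1}_i$, $x_j\in S^{k-1}_j$ attain this minimum. Then $x_i$ is called the exit point of order $k-1$ of $S^{k-1}_i$. Set $f^k(x_i)=x_j$ for every exit point of order $k-1$, and $f^k(y)=f^{k-1}(y)$ for all other points $y$. $[G^n,0]$ is the $f^n$-graph built on the Palm version $\Phi^0\cup\{0\}$, rooted at $0$. A component is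 of class $\mathcal{F/F}$ if it and all its foils are finite, where foils are the classes of $x\sim y\iff (f^n)^{(a)}(x)=(f^n)^{(b)}(y)$ for some $a,b\ge 0$ (iterates). *)

(* Defs.v *)
From HB Require Import structures.
From mathcomp Require Import all_boot all_order all_algebra.
From mathcomp Require Import all_classical all_reals all_analysis.
From Stdlib Require Import Relations.
Set Implicit Arguments. Unset Strict Implicit. Unset Printing Implicit Defensive.
Import Order.TTheory GRing.Theory Num.Theory.
Local Open Scope classical_set_scope.
Local Open Scope ring_scope.

Section CHN.
Variables (R : realType) (d : nat).
Notation point := 'rV[R]_d.

Definition edist (x y : point) : R :=
  Num.sqrt (\sum_(i < d) (x ord0 i - y ord0 i) ^+ 2).

Definition nn_rel (S : set point) (x y : point) : Prop :=
  S y /\ y <> x /\ forall z, S z -> z <> x -> z <> y -> edist x y < edist x z.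

Definition f0 (S : set point) (x : point) : point := xget x (nn_rel S x).

Definition level0_ok (S : set point) : Prop :=
  forall x, S x -> exists y, nn_rel S x y.

Definition edge (S : set point) (f : point -> point) (x y : point) : Prop :=
  S x /\ S y /\ f x = y.
Definition component (S : set point) (f : point -> point) (x : point) : set point :=
  [set y | clos_refl_sym_trans point (edge S f) x y].
Definition foil (S : set point) (f : point -> point) (x : point) : set point :=
  [set y | S y /\ exists a b : nat, iter a f x = iter b f y].

(* every component is of class F/F (finite, finite foils) and contains exactly
   one cycle, which has length 2 *)
Definition good_level (S : set point) (f : point -> point) : Prop :=
  (forall x, S x -> S (f x)) /\
  forall x, S x ->
    [/\ finite_set (component S f x),
        (forall y, component S f x y -> finite_set (foil S f y)) &
        exists a b, [/\ component S f x a /\ component S f x b, a <> b,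
                        f a = b, f b = a &
                        forall y k, component S f x y -> (0 < k)%N ->
                          iter k f y = y -> y = a \/ y = b]].

Definition head (S : set point) (f : point -> point) (x : point) : Prop :=
  S x /\ f x <> x /\ f (f x) = x.

(* u (in the pair {u, f u}) is the exit point of its pair and v the point of
   another pair attaining delta({u, f u}, other pairs); the minimum is strict *)
Definition exit_rel (S : set point) (f : point -> point) (u v : point) : Prop :=
  [/\ head S f u, head S f v, v <> u, v <> f u &
      forall u' v', (u' = u \/ u' = f u) -> head S f v' -> v' <> u -> v' <> f u ->
        (u', v') <> (u, v) -> edist u v < edist u' v'].

Definition next_shift (S : set point) (f : point -> point) (x : point) : point :=
  xget (f x) (exit_rel S f x).

Definition step_ok (S : set point) (f : point -> point) : Prop :=
  good_level S f /\
  forall a, head S f a -> exists u v, (u = a \/ u = f a) /\ exit_rel S f u v.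

Fixpoint chn (S : set point) (n : nat) : point -> point :=
  match n with
  | O => f0 S
  | k.+1 => next_shift S (chn S k)
  end.

Definition chn_wd (S : set point) (n : nat) : Prop :=
  level0_ok S /\ forall k, (k < n)%N -> step_ok S (chn S k).

Definition box (lo hi : point) : set point :=
  [set x | forall i, lo ord0 i <= x ord0 i < hi ord0 i].

Definition box_vol (lo hi : point) : R := \prod_(i < d) (hi ord0 i - lo ord0 i).

Definition count_eq {T : Type} (Phi : T -> set point) (B : set point) (k : nat)
  : set T :=
  [set w | exists s : seq point, [/\ uniq s, size s = k &
                                     Phi w `&` B = [set x | x \in s]]].

Definition poisson_pmf (mu : R) (k : nat) : R :=
  expR (- mu) * mu ^+ k / (k`!)%:R.

Definition is_hPPP {d0 : measure_display} {T : measurableType d0}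
  (P : probability T R) (lam : R) (Phi : T -> set point) : Prop :=
  (forall w lo hi, finite_set (Phi w `&` box lo hi)) /\
  (forall lo hi k, measurable (count_eq Phi (box lo hi) k)) /\
  (forall (n : nat) (lo hi : 'I_n -> point) (k : 'I_n -> nat),
     (forall i c, lo i ord0 c <= hi i ord0 c) ->
     (forall i j, i <> j -> box (lo i) (hi i) `&` box (lo j) (hi j) = set0) ->
     P (\bigcap_(i in [set: 'I_n]) count_eq Phi (box (lo i) (hi i)) (k i)) =
       (\prod_(i < n) poisson_pmf (lam * box_vol (lo i) (hi i)) (k i))%:E).

End CHN.

(* Main.v *)
Require Import Defs.
From HB Require Import structures.
From mathcomp Require Import all_boot all_order all_algebra.
From mathcomp Require Import all_classical all_reals all_analysis.
From mathcomp Require Import zify ring lra.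
From Stdlib Require Import Relations.
(* mathcomp-analysis also exports an [edist]; the one of [Defs] must win. *)
Import Defs.
Set Implicit Arguments. Unset Strict Implicit. Unset Printing Implicit Defensive.
Import Order.TTheory GRing.Theory Num.Theory.
Local Open Scope classical_set_scope.
Local Open Scope ring_scope.

(** At every level the cluster heads come in pairs of mutually nearest heads, and
    the distance from a pair to the nearest other pair strictly decreases when one
    follows the exit edges. A component can therefore be infinite only if there are
    arbitrarily long descending chains of exit edges. These are excluded
    deterministically as soon as, for arbitrarily large [L] and some [N] large
    compared with [L], (i) every ball of radius [L] centred in the ball of radius
    [N] contains two isolated hierarchical clusters of [2^k] points, each of which
    is forced to contain exactly one pair of heads of level [k], so that exit edges
    near the origin have length at most [2 L]; and (ii) the ball of radius [N]
    contains no descending chain of [n] steps of length at most [2 L], with [n L]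
    small compared with [N].

    For a Poisson process, (i) fails with probability polynomial in [N] times
    exponentially small in [L], by independence. For (ii), space is cut into small
    cells and the squared step lengths into bands so thin that the expected number
    of points in the corresponding annulus is small: the expected number of chains
    of [n] steps is then at most [2 ^ (number of bands) * 4 ^ - n], up to a
    polynomial factor. Ties are excluded by the same discretization. All
    estimates ignore the cell of the origin, hence apply to [Phi] and to
    [Phi `|` [set 0]] alike. *)

Section EuclideanDistance.
Variables (R : realType) (d : nat).
Implicit Types x y z : 'rV[R]_d.

Lemma sqr_edist x y : edist x y ^+ 2 = \sum_(i < d) (x ord0 i - y ord0 i) ^+ 2.
Proof. by rewrite sqr_sqrtr // sumr_ge0 // => i _; rewrite sqr_ge0. Qed.

Lemma edist_ge0 x y : 0 <= edist x y.
Proof. exact: sqrtr_ge0. Qed.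

Lemma edistC x y : edist x y = edist y x.
Proof. by congr Num.sqrt; apply: eq_bigr => i _; ring. Qed.

Lemma edistxx x : edist x x = 0.
Proof. by rewrite /edist big1 ?sqrtr0 // => i _; rewrite subrr expr0n. Qed.

Lemma edist_coord x y i : `|x ord0 i - y ord0 i| <= edist x y.
Proof.
rewrite -(ler_pXn2r (n := 2)) ?nnegrE ?edist_ge0 // sqr_edist -normrX.
rewrite ger0_norm ?sqr_ge0 // (bigD1 i) //= lerDl.
by rewrite sumr_ge0 // => j _; rewrite sqr_ge0.
Qed.

Lemma edist_eq0 x y : edist x y = 0 -> x = y.
Proof.
move=> xy0; apply/rowP => i; apply/eqP; rewrite -subr_eq0 -normr_le0 -xy0.
exact: edist_coord.
Qed.

Lemma edist_gt0 x y : x <> y -> 0 < edist x y.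
Proof.
by move=> xy; rewrite lt_def edist_ge0 andbT; apply/eqP => /edist_eq0.
Qed.

Lemma edist_le_coord x y (r : R) : 0 <= r ->
  (forall i, `|x ord0 i - y ord0 i| <= r) -> edist x y <= d%:R * r.
Proof.
move=> r0 h; rewrite -(ler_pXn2r (n := 2)) ?nnegrE ?edist_ge0 ?mulr_ge0 //.
rewrite sqr_edist (@le_trans _ _ (\sum_(i < d) r ^+ 2)) //.
  apply: ler_sum => i _; rewrite -[X in X <= _]ger0_norm ?sqr_ge0 // normrX.
  by rewrite ler_pXn2r ?nnegrE.
rewrite sumr_const card_ord exprMn -[X in X <= _]mulr_natl ler_wpM2r ?sqr_ge0 //.
by rewrite -natrX ler_nat; case: (d) => // n; rewrite leq_pmulr.
Qed.

Lemma sum_mul_sqr_le (a b : 'I_d -> R) :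
  (\sum_i a i * b i) ^+ 2 <= (\sum_i a i ^+ 2) * (\sum_i b i ^+ 2).
Proof.
set A := \sum_i a i ^+ 2; set B := \sum_i b i ^+ 2; set C := \sum_i a i * b i.
have A0 : 0 <= A by apply: sumr_ge0 => i _; rewrite sqr_ge0.
have q t s : 0 <= s ^+ 2 * A + 2 * (s * t) * C + t ^+ 2 * B.
  have -> : s ^+ 2 * A + 2 * (s * t) * C + t ^+ 2 * B =
      \sum_i (s * a i + t * b i) ^+ 2.
    rewrite !mulr_sumr -!big_split /=; apply: eq_bigr => i _; ring.
  by apply: sumr_ge0 => i _; rewrite sqr_ge0.
have [A1|A1] := eqVneq A 0.
  have a0 i : a i = 0.
    apply/eqP; rewrite -sqrf_eq0.
    move/eqP: A1; rewrite psumr_eq0 => [/allP/(_ i)|j _]; last exact: sqr_ge0.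
    by rewrite mem_index_enum => /(_ isT).
  by rewrite /C big1 ?expr0n ?mulr_ge0 // ?sumr_ge0 // => i _;
    rewrite ?a0 ?mul0r ?sqr_ge0.
have := q A (- C); have : 0 < A by rewrite lt_def A1.
by move=> Ap h; rewrite -(ler_pM2l Ap); nra.
Qed.

Lemma edist_triangle y x z : edist x z <= edist x y + edist y z.
Proof.
rewrite -(ler_pXn2r (n := 2)) ?nnegrE ?edist_ge0 ?addr_ge0 ?edist_ge0 //.
set a := fun i => x ord0 i - y ord0 i; set b := fun i => y ord0 i - z ord0 i.
have -> : edist x z ^+ 2 =
    edist x y ^+ 2 + 2 * (\sum_i a i * b i) + edist y z ^+ 2.
  rewrite !sqr_edist mulr_sumr -!big_split /=; apply: eq_bigr => i _.
  rewrite /a /b; ring.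
suff : \sum_i a i * b i <= edist x y * edist y z by lra.
rewrite (le_trans (ler_norm _)) //.
rewrite -(ler_pXn2r (n := 2)) ?nnegrE ?mulr_ge0 ?edist_ge0 //.
by rewrite -normrX ger0_norm ?sqr_ge0 // exprMn !sqr_edist sum_mul_sqr_le.
Qed.

Lemma edist_segment_left x y (t : R) : 0 <= t ->
  edist x (x + t *: (y - x)) = t * edist x y.
Proof.
move=> t0; rewrite -[in RHS](ger0_norm t0) -sqrtr_sqr /edist -sqrtrM ?sqr_ge0 //.
congr Num.sqrt; rewrite mulr_sumr; apply: eq_bigr => i _; rewrite !mxE; ring.
Qed.

Lemma edist_segment_right x y (t : R) : t <= 1 ->
  edist y (x + t *: (y - x)) = (1 - t) * edist x y.
Proof.
move=> t1; have -> : x + t *: (y - x) = y + (1 - t) *: (x - y).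
  by apply/rowP => i; rewrite !mxE; ring.
by rewrite edist_segment_left ?subr_ge0 // edistC.
Qed.

End EuclideanDistance.

Lemma finite_set_argmin (R : realType) (T : choiceType) (A : set T) (F : T -> R) :
  finite_set A -> A !=set0 -> exists2 x, A x & forall y, A y -> F x <= F y.
Proof.
move=> /finite_seqP[s ->]; elim: s => [[x]//|a s IH] _.
case: (pselect ([set` s] !=set0)) => [/IH[x xs xm]|s0].
  case: (leP (F a) (F x)) => ax.
    exists a => [|y]; first by rewrite /= mem_head.
    by rewrite /= inE => /orP[/eqP->//|/xm]; apply: le_trans.
  exists x => [|y]; first by rewrite /= inE xs orbT.
  by rewrite /= inE => /orP[/eqP->|/xm//]; apply: ltW.
exists a => [|y]; first by rewrite /= mem_head.
by rewrite /= inE => /orP[/eqP->//|ys]; case: s0; exists y.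
Qed.

(** * Cluster heads, exits and descending chains *)

Section Clusters.
Variables (R : realType) (d : nat).
Notation point := 'rV[R]_d.
Implicit Types (S D A : set point) (p f g : point -> point).

Definition no_ties S := forall x y u v, S x -> S y -> S u -> S v -> x <> y ->
  edist x y = edist u v -> (x = u /\ y = v) \/ (x = v /\ y = u).

Definition locally_finite S :=
  forall r : R, finite_set (S `&` [set x | edist 0 x <= r]).

(* [D] is the set of current cluster heads, grouped in classes [{x, p x}]; the
   choice [D := S], [p := id] turns this into the nearest neighbour relation. *)
Definition exits D p (u v : point) :=
  [/\ D u, D v, v <> u, v <> p u &
      forall u' v', (u' = u \/ u' = p u) -> D v' -> v' <> u -> v' <> p u ->
        (u', v') <> (u, v) -> edist u v < edist u' v'].

Record level S D p f : Prop := Level {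
  level_sub : forall x, D x -> S x;
  level_partner : forall x, D x -> D (p x);
  level_inv : forall x, D x -> p (p x) = x;
  level_stable : forall x, S x -> S (f x);
  level_restr : forall x, D x -> f x = p x;
  level_reach : forall x, S x -> exists m, D (iter m f x);
  level_basin : forall x, D x ->
    finite_set [set z | S z /\ exists m, iter m f z = x];
  level_close : forall x y, D x -> D y -> y <> x -> y <> p x ->
    edist x (p x) < edist x y }.

Fixpoint block S (k : nat) A : Prop :=
  match k with
  | 0%N => exists2 a, S a & A = [set a]
  | k'.+1 => exists A1 A2, [/\ block S k' A1, block S k' A2,
      A = A1 `|` A2, A1 `&` A2 = set0 & exists r : R,
      (forall a b, A a -> A b -> edist a b < r) /\
      (forall a b, A a -> S b -> ~ A b -> r <= edist a b)]
  end.

Definition block_single S D p k := forall A, block S k A ->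
  exists u, [/\ A u, A (p u), D u & forall y, A y -> D y -> y = u \/ y = p u].

(* A descending chain [u -> v ~> u' -> v' ~> ...] is stored as its first point
   and the list of the pairs [(v, u')]; [flat] lists its points, keeping one
   copy of [v] and [u'] when they coincide. *)
Fixpoint flat (st : seq (point * point)) : seq point :=
  match st with
  | [::] => [::]
  | (v, u) :: st' => v :: (if v == u then [::] else [:: u]) ++ flat st'
  end.

Fixpoint dchain S (L N B : R) (u : point) (st : seq (point * point)) : Prop :=
  match st with
  | [::] => S u /\ edist 0 u <= N
  | (v, u') :: st' => [/\ S u /\ edist 0 u <= N, S v /\ edist 0 v <= N,
      edist u v <= L /\ edist u v <= B, edist v u' <= L &
      dchain S L N (edist u v) u' st']
  end.

Definition scale S k (N0 : R) := exists (L N : R) (n : nat),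
  [/\ 0 < L, N0 + (4 * n%:R + 8) * L <= N,
      (forall c, edist 0 c <= N -> exists A1 A2,
         [/\ block S k A1, block S k A2, A1 `&` A2 = set0 &
             A1 `|` A2 `<=` [set y | edist c y < L]]) &
      (forall u st B, dchain S (2 * L) N B u st -> uniq (u :: flat st) ->
         (size st < n)%N)].

Section Step.
Variables (S D : set point) (p f g : point -> point) (k : nat).
Hypothesis ties : no_ties S.
Hypothesis lfin : locally_finite S.
Hypothesis scales : forall N0, scale S k N0.
Hypothesis lev : level S D p f.
Hypothesis blk : block_single S D p k.
Hypothesis g_exit : forall x v, exits D p x v -> g x = v.
Hypothesis g_same : forall x, S x -> (forall v, ~ exits D p x v) -> g x = f x.

Local Notation E := (exits D p).
Let DS := level_sub lev.
Let Dp := level_partner lev.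
Let pp := level_inv lev.

Lemma other_head x (A1 A2 : set point) : D x -> block S k A1 -> block S k A2 ->
  A1 `&` A2 = set0 -> exists y, [/\ (A1 `|` A2) y, D y, y <> x & y <> p x].
Proof.
move=> Dx b1 b2 A12.
have [y1 [A1y A1py Dy1 _]] := blk b1; have [y2 [A2y _ Dy2 _]] := blk b2.
have A12n z : A1 z -> A2 z -> False.
  by move=> a b; have : (A1 `&` A2) z by []; rewrite A12.
have [y1x|y1x] := eqVneq y1 x.
  subst y1; exists y2; split => //; [by right| |]; move=> e; subst y2;
    exact: (A12n _ _ A2y).
have [y1px|y1px] := eqVneq y1 (p x).
  subst y1; rewrite pp // in A1py.
  by exists y2; split => //; [by right| |]; move=> e; subst y2; exact: (A12n _ _ A2y).
by exists y1; split=> //; [left|apply/eqP|apply/eqP].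
Qed.

Lemma exit_exists x : D x -> exists u v, (u = x \/ u = p x) /\ E u v.
Proof.
move=> Dx; have [L [N [n [L0 LN hb _]]]] := scales (edist 0 x).
have [|A1 [A2 [b1 b2 A12 _]]] := hb x.
  by rewrite (le_trans _ LN) // lerDl mulr_ge0 ?ltW // addr_ge0 // mulr_ge0.
have [y [_ Dy yx ypx]] := other_head Dx b1 b2 A12.
pose r := edist 0 x + edist x (p x) + edist x y.
pose C := [set uv : point * point | [/\ uv.1 = x \/ uv.1 = p x,
   (S `&` [set z | edist 0 z <= r]) uv.2, D uv.2, uv.2 <> x & uv.2 <> p x]].
have Cfin : finite_set C.
  apply: (@sub_finite_set _ _ ([set x; p x] `*` (S `&` [set z | edist 0 z <= r]))).
    by move=> [a b] [].
  by apply: finite_setX => //; exact: finite_set2.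
have Cy : C (x, y).
  split; rewrite //=; first by left.
  split; first exact: DS.
  by rewrite /= (le_trans (edist_triangle x _ _)) // lerD2r lerDl edist_ge0.
have [[u v] [/= hu [Sv vr] Dv vx vpx] umin] :=
  finite_set_argmin (fun uv => edist uv.1 uv.2) Cfin (ex_intro _ _ Cy).
have Du : D u by case: hu => ->; [|apply: Dp].
have cu z : (z = u \/ z = p u) <-> (z = x \/ z = p x).
  by case: hu => ->; rewrite ?pp //; split; case; auto.
exists u, v; split=> //.
have vu : v <> u by move=> vu; have := proj1 (cu v) (or_introl vu); case.
have vpu : v <> p u by move=> vu'; have := proj1 (cu v) (or_intror vu'); case.
split=> // u' v' /cu hu' Dv' v'u v'pu neq.
have v'x : v' <> x by move=> e; have := proj2 (cu v') (or_introl e); case.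
have v'px : v' <> p x by move=> e; have := proj2 (cu v') (or_intror e); case.
have Du' : D u' by case: hu' => ->; [|apply: Dp].
have le_uv : edist u v <= edist u' v'.
  have [v'r|/ltW v'r] := leP (edist 0 v') r.
    by apply: (umin (u', v')); split=> //; split=> //; exact: DS.
  apply: le_trans (umin _ Cy) _; rewrite /=.
  have := edist_triangle u' 0 v'.
  have : edist 0 u' <= edist 0 x + edist x (p x).
    case: hu' => ->; last exact: edist_triangle.
    by rewrite lerDl edist_ge0.
  by move: v'r; rewrite /r; lra.
rewrite lt_def le_uv andbT; apply/eqP => e.
have [] := ties (DS Du') (DS Dv') (DS Du) (DS Dv) _ e.
- by move=> uv'; move: hu'; rewrite uv' => -[].
- by move=> [? ?]; apply: neq; subst.
- by move=> [_ v'u'].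
Qed.

Lemma exit_fun u v v' : E u v -> E u v' -> v = v'.
Proof.
move=> [Du Dv vu vpu m] [_ Dv' v'u v'pu m']; apply: contrapT => vv'.
have := m u v' (or_introl erefl) Dv' v'u v'pu.
have := m' u v (or_introl erefl) Dv vu vpu.
have n1 : (u, v) <> (u, v') by case.
have n2 : (u, v') <> (u, v) by case=> /esym.
by move=> /(_ n1) a /(_ n2) b; have := lt_trans a b; rewrite ltxx.
Qed.

Lemma exit_class u u' v v' : E u v -> E u' v' -> (u' = u \/ u' = p u) -> u' = u.
Proof.
move=> [Du Dv vu vpu m] [Du' Dv' v'u' v'pu' m'] [//|u'p].
apply: contrapT => u'u; rewrite u'p pp // in v'pu' m'.
rewrite u'p in v'u' m' u'u.
have n1 : (p u, v') <> (u, v) by case.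
have n2 : (u, v) <> (p u, v') by case=> /esym.
have a := m (p u) v' (or_intror erefl) Dv' v'pu' v'u' n1.
have b := m' u v (or_intror erefl) Dv vpu vu n2.
by have := lt_trans a b; rewrite ltxx.
Qed.

Lemma exit_le u v u' v' : E u v -> (u' = u \/ u' = p u) -> D v' ->
  v' <> u -> v' <> p u -> edist u v <= edist u' v'.
Proof.
move=> [Du Dv vu vpu m] hu' Dv' v'u v'pu.
case: (pselect ((u', v') = (u, v))) => [[-> ->]//|n]; exact/ltW/m.
Qed.

Lemma exit_reverse u v u2 v2 : E u v -> (u2 = v \/ u2 = p v) -> E u2 v2 ->
  edist u2 v2 < edist u v \/ (u2 = v /\ v2 = u).
Proof.
move=> [Du Dv vu vpu m] hu2 [Du2 Dv2 v2u2 v2pu2 m2].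
have cv : v = u2 \/ v = p u2 by case: hu2 => ->; rewrite ?pp; auto.
have uu2 : u <> u2.
  by case: hu2 => -> // e; [exact: vu|apply: vpu; rewrite e pp].
have upu2 : u <> p u2.
  by case: hu2 => ->; rewrite ?pp // => e; [apply: vpu; rewrite e pp|apply: vu].
case: (pselect ((v, u) = (u2, v2))) => [[-> ->]|n]; first by right.
by left; rewrite (edistC u); exact: m2.
Qed.

Definition del (y : point) : R :=
  xget 0 [set r | exists u v, [/\ u = y \/ u = p y, E u v & r = edist u v]].

Lemma del_class y u v : D y -> (u = y \/ u = p y) -> E u v -> del y = edist u v.
Proof.
move=> Dy hu Euv; apply: xget_unique; first by exists u, v.
move=> r [u' [v' [hu' Euv' ->]]].
have uu : u' = u.
  apply: (exit_class Euv Euv').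
  by case: hu hu' => -> [] ->; rewrite ?pp; auto.
by rewrite uu in Euv' *; rewrite (exit_fun Euv Euv').
Qed.

Lemma del_exit u v : E u v -> del u = edist u v.
Proof. by move=> Euv; apply: del_class => //; [case: Euv|left]. Qed.

Lemma del_partner y : D y -> del (p y) = del y.
Proof.
move=> Dy; have [u [v [hu Euv]]] := exit_exists Dy.
rewrite (del_class Dy hu Euv); apply: (del_class (Dp Dy) _ Euv).
by rewrite pp //; case: hu; auto.
Qed.

Fixpoint echain (u : point) (st : seq (point * point)) : Prop :=
  match st with
  | [::] => exists v, E u v
  | (v, u') :: st' =>
      [/\ E u v, u' = v \/ u' = p v, del u' < del u & echain u' st']
  end.

Lemma echain_head u st : echain u st -> exists v, E u v.
Proof. by case: st => [//|[v u'] st] [Euv _ _ _]; exists v. Qed.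

Lemma echain_uniq u st : echain u st ->
  uniq (u :: flat st) /\ forall y, y \in flat st -> del y < del u.
Proof.
elim: st u => [//|[v u'] st IH] u [Euv hu' lt_u ch] /=.
have [/= /andP[u'st unst] lt_st] := IH _ ch.
have Dv : D v by case: Euv.
have dv : del v = del u' by case: hu' => ->; rewrite ?del_partner.
have lt_all y : y \in v :: (if v == u' then [::] else [:: u']) ++ flat st ->
    del y < del u.
  rewrite inE mem_cat => /or3P[/eqP->|yu'|/lt_st /lt_trans]; first by rewrite dv.
    suff -> : y = u' by [].
    by move: yu'; case: ifP => // _; rewrite inE => /eqP.
  exact.
split=> //; apply/andP; split.
  by apply/negP => /lt_all; rewrite ltxx.
have vst : v \notin flat st by apply/negP => /lt_st; rewrite dv ltxx.
case: eqP => [_|/eqP vu'] /=; first by rewrite vst.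
by rewrite inE negb_or vu' vst u'st.
Qed.

Section Scale.
Variables (L N : R) (n : nat).
Hypothesis L0 : 0 < L.
Hypothesis hblock : forall c, edist 0 c <= N -> exists A1 A2,
  [/\ block S k A1, block S k A2, A1 `&` A2 = set0 &
      A1 `|` A2 `<=` [set y | edist c y < L]].
Hypothesis hchain : forall u st B, dchain S (2 * L) N B u st ->
  uniq (u :: flat st) -> (size st < n)%N.

(* A longer exit would leave a ball of radius [L] around a point of the ball of
   radius [N] free of heads of other classes. *)
Lemma exit_short u v : E u v -> edist 0 u <= N - L \/ edist 0 v <= N - L ->
  edist u v <= 2 * L.
Proof.
move=> Euv near; rewrite leNgt; apply/negP => Luv.
set r := edist u v in Luv; have r0 : 0 < r by move: L0 Luv; lra.
have Du : D u by case: Euv.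
suff [c [cN uc]] : exists c, edist 0 c <= N /\ edist u c <= r - L.
  have [A1 [A2 [b1 b2 A12 sub]]] := hblock cN.
  have [y [Ay Dy yu ypu]] := other_head Du b1 b2 A12.
  have := exit_le Euv (or_introl erefl) Dy yu ypu.
  have := edist_triangle c u y; have := sub _ Ay; rewrite /= -/r; lra.
case: near => near.
  by exists u; rewrite edistxx; move: L0 Luv; split; lra.
have Lr : 0 <= L / r by rewrite divr_ge0 // ltW.
have Lr1 : L / r <= 1 by rewrite ler_pdivrMr // mul1r; move: L0 Luv; lra.
exists (v + (L / r) *: (u - v)); split.
  rewrite (le_trans (edist_triangle v _ _)) // edist_segment_left //.
  by rewrite (edistC v u) -/r divfK ?gt_eqF //; lra.
rewrite edist_segment_right // (edistC v u) -/r mulrBl mul1r divfK //.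
by rewrite gt_eqF.
Qed.

Lemma class_short u v x : E u v -> edist 0 u <= N - L -> (x = u \/ x = p u) ->
  edist x u <= 2 * L.
Proof.
move=> Euv uN hx; have := exit_short Euv (or_introl uN).
case: (Euv) => Du Dv vu vpu _; case: hx => ->.
  by rewrite edistxx => _; rewrite mulr_ge0 // ltW.
apply: le_trans; rewrite edistC; apply/ltW; exact: (level_close lev).
Qed.

Lemma echain_cons u v u' st : E u v -> (u' = v \/ u' = p v) -> del u' < del u ->
  echain u' st -> dchain S (2 * L) N (del u') u' st -> edist 0 u <= N ->
  edist 0 v <= N -> edist u v <= 2 * L -> edist 0 u' <= N - L ->
  echain u ((v, u') :: st) /\ dchain S (2 * L) N (del u) u ((v, u') :: st).
Proof.
move=> Euv hu' lt_u ech dch uN vN uvL u'N; split=> //.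
have [v' Eu'] := echain_head ech.
have [Du Dv _ _ _] := Euv; rewrite /= (del_exit Euv); split=> //.
- by split=> //; exact: DS.
- by split=> //; exact: DS.
- apply: (class_short Eu') => //.
  by case: hu' => ->; rewrite ?pp; auto.
- rewrite -(del_exit Euv).
  have {}lt_u := ltW lt_u.
  move: dch lt_u; clear; case: st => [//|[a b] st] /= [h1 h2 [h3 h4] h5 h6] lt_u.
  by split=> //; split=> //; apply: le_trans lt_u.
Qed.

Definition terminal x := exists v, E x v /\ E v x.

Lemma terminal_g x : terminal x -> terminal (g x) /\ g (g x) = x.
Proof.
move=> [v [Exv Evx]]; rewrite (g_exit Exv) (g_exit Evx); split=> //.
by exists x.
Qed.

Lemma non_exit_g x : D x -> (forall v, ~ E x v) -> g x = p x.
Proof. by move=> Dx nE; rewrite g_same ?(level_restr lev) //; exact: DS. Qed.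

Lemma descending_chain m u (r : R) : (exists v, E u v) ->
  (forall j, ~ terminal (iter j g u)) -> edist 0 u <= r ->
  r + (4 * m%:R + 4) * L <= N ->
  exists st, [/\ size st = m, echain u st & dchain S (2 * L) N (del u) u st].
Proof.
elim: m u r => [|m IH] u r [v Euv] nT ur rN.
  exists [::]; split=> //; first by exists v.
  split; first by apply: DS; case: Euv.
  move: ur rN L0; lra.
have mL : 0 <= m%:R * L by rewrite mulr_ge0 // ltW.
have m1 : m.+1%:R * L = m%:R * L + L by rewrite -natr1; ring.
have Dv : D v by case: Euv.
have uvL : edist u v <= 2 * L.
  by apply: (exit_short Euv); left; move: ur rN L0; nra.
have [u2 [v2 [hu2 Eu2]]] := exit_exists Dv.
have vN : edist 0 v <= r + 2 * L.
  by have := edist_triangle u 0 v; move: ur uvL; lra.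
have [lt_u|[u2v v2u]] := exit_reverse Euv hu2 Eu2; last first.
  by case: (nT 0%N); exists v; split=> //; subst.
have vu2 : edist v u2 <= 2 * L.
  have [->|u2v] := hu2; first by rewrite edistxx mulr_ge0 // ltW.
  rewrite u2v (le_trans _ uvL) // (le_trans _ (ltW lt_u)) //.
  rewrite edistC -{2}(pp Dv) -u2v; apply/ltW.
  by case: Eu2 => Du2 Dv2 ? ? _; apply: (level_close lev).
have u2N : edist 0 u2 <= r + 4 * L.
  by have := edist_triangle v 0 u2; move: vN vu2; lra.
have nT2 j : ~ terminal (iter j g u2).
  have [i ->] : exists i, u2 = iter i g u.
    have [u2v|/eqP u2v] := eqVneq u2 v; first by exists 1%N; rewrite /= (g_exit Euv).
    exists 2; rewrite /= (g_exit Euv) non_exit_g //; first by case: hu2.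
    move=> v3 Ev; apply: u2v; apply/esym; apply: (exit_class Eu2 Ev).
    by case: hu2 => ->; rewrite ?pp; auto.
  by rewrite -iterD.
have [st [sz ech dch]] : exists st,
    [/\ size st = m, echain u2 st & dchain S (2 * L) N (del u2) u2 st].
  apply: (IH _ (r + 4 * L)) => //; first by exists v2.
  by move: rN; rewrite -natr1; nra.
rewrite -(del_exit Eu2) -(del_exit Euv) in lt_u.
exists ((v, u2) :: st).
have [||//||ech' dch'] := @echain_cons u v u2 st Euv hu2 lt_u ech dch.
- by move: ur rN L0; nra.
- by move: vN rN L0; nra.
- by move: u2N rN L0; nra.
by split=> //=; rewrite sz.
Qed.

Lemma reach_terminal x : D x ->
  edist 0 x + edist x (p x) + (4 * n%:R + 4) * L <= N ->
  exists m, terminal (iter m g x).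
Proof.
move=> Dx xN; apply: contrapT => /forallNP nT.
have [u [v [hu Euv]]] := exit_exists Dx.
have [i ui] : exists i, u = iter i g x.
  have [->|/eqP ux] := eqVneq u x; first by exists 0%N.
  exists 1%N; rewrite /= non_exit_g //; first by case: hu.
  move=> v' Ex; apply: ux; apply/esym; apply: (exit_class Euv Ex).
  by case: hu => ->; rewrite ?pp; auto.
have [|||st [sz ech dch]] :=
    @descending_chain n u (edist 0 x + edist x (p x)) _ _ _ xN.
- by exists v.
- by move=> j; rewrite ui -iterD.
- case: hu => ->; last exact: edist_triangle.
  by rewrite lerDl edist_ge0.
by have := hchain dch (proj1 (echain_uniq ech)); rewrite sz ltnn.
Qed.

Lemma terminal_iter x m : terminal x -> iter m g x = x \/ iter m g x = g x.
Proof.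
move=> Tx; elim: m => [|m IH]; first by left.
by rewrite iterS; case: IH => ->; [right|left; case: (terminal_g Tx)].
Qed.

Lemma chain_to_terminal a m x : D x -> terminal a -> iter m g x = a ->
  exists u st, [/\ u = x \/ u = p x, echain u st &
    let b := last u (unzip2 st) in b = a \/ b = g a].
Proof.
move=> Dx Ta; elim: m x Dx => [|m IH] x Dx.
  move=> /= ->; exists a, [::]; split=> //=; first by left.
    by case: Ta => v []; exists v.
  by left.
rewrite iterSr => hm.
case: (pselect (exists v, E x v)) => [[v Exv]|/forallNP nE]; last first.
  rewrite non_exit_g // in hm; have [u [st [hu ech hl]]] := IH _ (Dp Dx) hm.
  by exists u, st; split=> //; case: hu => ->; rewrite ?pp; auto.
have Dv : D v by case: Exv.
have gx := g_exit Exv; rewrite gx in hm.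
have [u [st [hu ech hl]]] := IH _ Dv hm.
have [v2 Eu] := echain_head ech.
have [lt_x|[uv v2x]] := exit_reverse Exv hu Eu.
  exists x, ((v, u) :: st); split=> //=; first by left.
  by split=> //; rewrite (del_exit Eu) (del_exit Exv).
exists x, [::]; split=> /=; [by left|by exists v|].
have Tx : terminal x by exists v; split=> //; subst.
have [_ ggx] := terminal_g Tx; have [Tv ggv] := terminal_g Tx.
rewrite gx in Tv ggv.
have := terminal_iter m Tv; rewrite hm => -[->|->]; first by right; rewrite ggv.
by left; rewrite ggv.
Qed.

Lemma chain_bounded (r : R) u st : 0 <= r -> r + (4 * n%:R + 4) * L <= N ->
  echain u st -> edist 0 (last u (unzip2 st)) <= r ->
  [/\ (size st < n)%N, edist 0 u <= r + 4 * (size st)%:R * L &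
      dchain S (2 * L) N (del u) u st].
Proof.
move=> r0 rN; elim: st u => [|[v u'] st IH] u.
  move=> /= ech ur; have [v Euv] := ech.
  have uS : S u by apply: DS; case: Euv.
  have nL : 0 <= n%:R * L by rewrite mulr_ge0 // ltW.
  have dch : dchain S (2 * L) N 0 u [::] by split=> //; move: ur rN L0; nra.
  split; [exact: (hchain dch)|by rewrite mulr0 mul0r addr0|by case: dch].
move=> /= [Euv hu' lt_u ech] ul; have [szn u'r dch] := IH _ ech ul.
have szL : (size st).+1%:R * L <= n%:R * L by apply: ler_wpM2r; [exact: ltW|rewrite ler_nat].
have sz1 : (size st).+1%:R * L = (size st)%:R * L + L by rewrite -natr1; ring.
have s0 : 0 <= (size st)%:R * L by rewrite mulr_ge0 // ltW.
have u'N : edist 0 u' <= N - L by move: u'r rN szL L0; nra.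
have [v' Eu'] := echain_head ech.
have Dv : D v by case: Euv.
have vu' : edist v u' <= 2 * L.
  by apply: (class_short Eu' u'N); case: hu' => ->; rewrite ?pp; auto.
have vr := edist_triangle u' 0 v; rewrite (edistC u') in vr.
have uvL : edist u v <= 2 * L.
  by apply: (exit_short Euv); right; move: vr u'r vu' rN szL L0; nra.
have ur := edist_triangle v 0 u; rewrite (edistC v) in ur.
have [||//|//|ech' dch'] := echain_cons Euv hu' lt_u ech dch.
- by move: ur vr u'r vu' uvL rN szL L0; nra.
- by move: vr u'r vu' uvL rN szL L0; nra.
split=> //; first exact: (hchain dch' (proj1 (echain_uniq ech'))).
by move: ur vr u'r vu' uvL L0; nra.
Qed.

Lemma terminal_basin_bounded x a m : D x -> terminal a -> iter m g x = a ->
  edist 0 a + edist a (g a) + (4 * n%:R + 8) * L <= N -> edist 0 x <= N.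
Proof.
move=> Dx Ta xa aN; have [u [st [hu ech hl]]] := chain_to_terminal Dx Ta xa.
have [|||szn ur dch] := @chain_bounded (edist 0 a + edist a (g a)) u st _ _ ech.
- by rewrite addr_ge0 ?edist_ge0.
- by move: aN L0; lra.
- move: hl => /= [->|->]; last exact: edist_triangle.
  by rewrite lerDl edist_ge0.
have [v Eu] := echain_head ech.
have szL : (size st)%:R * L <= n%:R * L by apply: ler_wpM2r; [exact: ltW|rewrite ler_nat ltnW].
have uN : edist 0 u <= N - L by move: ur aN szL L0; nra.
have := edist_triangle u 0 x.
have : edist x u <= 2 * L.
  by apply: (class_short Eu uN); case: hu => ->; rewrite ?pp; auto.
by rewrite (edistC x); move: ur aN szL L0; nra.
Qed.

End Scale.

Lemma terminal_iterT m x : terminal x -> terminal (iter m g x).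
Proof. by move=> Tx; elim: m => //= m /terminal_g[]. Qed.

Lemma g_stable x : S x -> S (g x).
Proof.
move=> Sx; case: (pselect (exists v, E x v)) => [[v Exv]|/forallNP nE].
  by rewrite (g_exit Exv); apply: DS; case: Exv.
by rewrite g_same //; exact: (level_stable lev).
Qed.

Lemma iter_stable m x : S x -> S (iter m g x).
Proof. by move=> Sx; elim: m => //= m; exact: g_stable. Qed.

Lemma reach_head x : S x ->
  exists2 m, D (iter m f x) & iter m f x = iter m g x.
Proof.
move=> Sx; have [m] := level_reach lev Sx; elim: m x Sx => [|m IH] x Sx Dm.
  by exists 0%N.
case: (pselect (D x)) => [Dx|nDx]; first by exists 0%N.
rewrite iterSr in Dm.
have [m' Dm' em'] := IH _ (level_stable lev Sx) Dm.
have gx : g x = f x by apply: g_same => // v [].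
by exists m'.+1; rewrite !iterSr ?gx.
Qed.

Lemma reach x : S x -> exists m, terminal (iter m g x).
Proof.
move=> Sx; have [m Dm em] := reach_head Sx; set y := iter m f x in Dm em.
have [L [N [n [L0 LN hb hc]]]] := scales (edist 0 y + edist y (p y)).
have [|m' Tm] := reach_terminal L0 hb hc Dm; first by move: LN L0; lra.
by exists (m' + m)%N; rewrite iterD -em.
Qed.

Lemma periodic_terminal x j : S x -> (0 < j)%N -> iter j g x = x -> terminal x.
Proof.
move=> Sx j0 xj; have [m Tm] := reach Sx.
have xjm i : iter (i * j) g x = x by elim: i => // i IH; rewrite mulSn iterD IH.
have mj : (m <= m * j)%N by rewrite leq_pmulr.
by rewrite -(xjm m) -(subnK mj) iterD; exact: terminal_iterT.
Qed.

Lemma exit_neq u v : E u v -> u <> v.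
Proof. by case=> _ _ vu _ _ /esym. Qed.

Lemma head_terminal x : head S g x <-> terminal x.
Proof.
split=> [[Sx [_ ggx]]|Tx]; first exact: (@periodic_terminal x 2).
have [v [Exv Evx]] := Tx; split; first by apply: DS; case: Exv.
rewrite (g_exit Exv) (g_exit Evx); split=> //; exact: exit_neq Evx.
Qed.

Lemma basin_finite a : terminal a ->
  finite_set [set z | S z /\ exists m, iter m g z = a].
Proof.
move=> Ta; have [L [N [n [L0 LN hb hc]]]] := scales (edist 0 a + edist a (g a)).
apply: (@sub_finite_set _ _ (\bigcup_(x in D `&` (S `&` [set x | edist 0 x <= N]))
   [set z | S z /\ exists m, iter m f z = x])); last first.
  apply: bigcup_finite => [|x [Dx _]]; last exact: (level_basin lev).
  by apply: sub_finite_set (lfin N); apply: subIsetr.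
move=> z [Sz [m zm]]; have [m' Dm em] := reach_head Sz.
set x := iter m' f z in Dm em.
exists x; last by split=> //; exists m'.
split=> //; split; first exact: DS.
have [j xj] : exists j, iter j g x = a.
  have [le_m|/ltnW le_m] := leqP m' m.
    by exists (m - m')%N; rewrite em -iterD subnK.
  have : x = iter (m' - m) g a by rewrite -zm -iterD subnK.
  have [->|->] := terminal_iter (m' - m) Ta => ->; first by exists 0%N.
  by exists 1%N => /=; case: (terminal_g Ta).
exact: (terminal_basin_bounded L0 hb hc Dm Ta xj LN).
Qed.

Lemma next_level : level S (head S g) g g.
Proof.
split=> [x []//|x /head_terminal Tx|x [_ []]//|x|//|x Sx|x /head_terminal Tx|].
- by apply/head_terminal; case: (terminal_g Tx).
- exact: g_stable.
- by have [m Tm] := reach Sx; exists m; apply/head_terminal.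
- exact: basin_finite.
move=> x y /head_terminal[v [Exv Evx]] /head_terminal[v' [Eyv' _]] yx ygx.
rewrite (g_exit Exv) in ygx *; case: (Exv) => Dx _ _ _ m.
have Dy : D y by case: Eyv'.
apply: m => //; [by left| |by case].
by move=> ypx; apply: yx; apply: (exit_class Exv Eyv'); right.
Qed.

Definition flows (a z : point) := exists m, iter m g z = a \/ iter m g z = g a.

Lemma flows_g a z : terminal a -> flows a z <-> flows a (g z).
Proof.
move=> Ta; have [_ gga] := terminal_g Ta; split; last first.
  by move=> [m]; rewrite -iterSr => h; exists m.+1.
move=> [[|m]]; last by rewrite iterSr => h; exists m.
by move=> /= h; exists 0%N => /=; case: h => ->; [right|left].
Qed.

Lemma component_flows a x y : terminal a -> component S g x y ->
  (S x <-> S y) /\ (flows a x <-> flows a y).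
Proof.
move=> Ta; elim=> {x y} [x y [Sx [Sy <-]]|//|x y _ [h1 h2]|x y z _ [h1 h2] _ [h3 h4]].
- by split; [split=> // _; exact: g_stable|exact: flows_g].
- by split; apply: iff_sym.
- by split; [apply: (iff_trans h1)|apply: (iff_trans h2)].
Qed.

Lemma flows_finite a : terminal a -> finite_set [set z | S z /\ flows a z].
Proof.
move=> Ta; have [Tga _] := terminal_g Ta.
apply: sub_finite_set (_ : finite_set
  ([set z | S z /\ exists m, iter m g z = a] `|`
   [set z | S z /\ exists m, iter m g z = g a])).
  by move=> z [Sz [m [h|h]]]; [left|right]; split=> //; exists m.
by rewrite finite_setU; split; exact: basin_finite.
Qed.

Lemma component_iter m x : S x -> component S g x (iter m g x).
Proof.
move=> Sx; elim: m => [|m IH]; first exact: rst_refl.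
apply: rst_trans IH _; apply: rst_step; split; first exact: iter_stable.
by split=> //; exact: iter_stable m.+1 _ Sx.
Qed.

Lemma next_good : good_level S g.
Proof.
split=> [x|x Sx]; first exact: g_stable.
have [m Ta] := reach Sx; set a := iter m g x in Ta.
have xa : flows a x by exists m; left.
have cf y : component S g x y -> S y /\ flows a y.
  by move=> /(component_flows Ta) [h1 h2]; split; [apply/h1|apply/h2].
have [Tga gga] := terminal_g Ta.
split.
- by apply: sub_finite_set (flows_finite Ta) => y; exact: cf.
- move=> y /cf[Sy [i ya]]; apply: sub_finite_set (flows_finite Ta) => z.
  move=> [Sz [b [c bc]]]; split=> //; exists (i + c)%N.
  rewrite iterD -bc -iterD addnC iterD.
  case: ya => ->; first exact: terminal_iter.
  by have [->|->] := terminal_iter b Tga; [right|left].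
- exists a, (g a); split=> //.
  + by split; [exact: component_iter|exact: (component_iter m.+1)].
  + by case: Ta => v [Ev _]; rewrite (g_exit Ev); exact: exit_neq Ev.
  + move=> y j /cf[Sy [i ya]] j0 yj; have Ty := periodic_terminal Sy j0 yj.
    have [_ ggy] := terminal_g Ty.
    move: ya; have [->|->] := terminal_iter i Ty; first by [].
    by move=> [<-|gya]; [right|left; rewrite -ggy gya].
Qed.

Lemma next_block : block_single S (head S g) g k.+1.
Proof.
move=> A [A1 [A2 [b1 b2 AE A12 [r [rin rout]]]]].
have [u1 [A1u A1pu Du1 A1m]] := blk b1; have [u2 [A2u A2pu Du2 A2m]] := blk b2.
have A12n z : A1 z -> A2 z -> False.
  by move=> a b; have : (A1 `&` A2) z by []; rewrite A12.
have main (B1 B2 : set point) w1 w2 : A = B1 `|` B2 -> (forall z, B1 z -> B2 z -> False) ->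
    B1 w1 -> B1 (p w1) -> D w1 -> (forall y, B1 y -> D y -> y = w1 \/ y = p w1) ->
    B2 w2 -> D w2 -> (forall y, B2 y -> D y -> y = w2 \/ y = p w2) ->
    exists x v, [/\ x = w1 \/ x = p w1, E x v & v = w2 \/ v = p w2].
  move=> AB B12 B1w B1p Dw1 B1m B2w Dw2 B2m.
  have [x [v [hx Exv]]] := exit_exists Dw1.
  have Ax : A x by rewrite AB; left; case: hx => ->.
  have [Dx Dv vx vpx _] := Exv.
  have cx z : z = x \/ z = p x -> z = w1 \/ z = p w1.
    by case: hx => ->; rewrite ?pp //; case; auto.
  have Av : A v.
    apply: contrapT => nAv; have := rout _ _ Ax (DS Dv) nAv.
    have Aw1 : A w1 by rewrite AB; left.
    have Aw2 : A w2 by rewrite AB; right.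
    rewrite leNgt => /negP; apply; apply: le_lt_trans (rin _ _ Aw1 Aw2).
    have w2n z : z = w1 \/ z = p w1 -> w2 <> z.
      by move=> hz wz; apply: (B12 w2) => //; rewrite wz; case: hz => ->.
    apply: (exit_le Exv) => //.
    - by case: hx => ->; rewrite ?pp; auto.
    - by apply: w2n; apply: cx; left.
    - by apply: w2n; apply: cx; right.
  exists x, v; split=> //; apply: (B2m _ _ Dv).
  move: Av; rewrite AB => -[B1v|//].
  have := B1m _ B1v Dv; case: hx => ex; subst x; first by case.
  by rewrite pp // in vpx; case.
have [x1 [v1 [hx1 E1 hv1]]] := main A1 A2 u1 u2 AE A12n A1u A1pu Du1 A1m A2u Du2 A2m.
have [||x2 [v2 [hx2 E2 hv2]]] := main A2 A1 u2 u1 _ _ A2u A2pu Du2 A2m A1u Du1 A1m.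
- by rewrite setUC.
- by move=> z /[swap]; exact: A12n.
have cls (w a b : point) : D w -> a = w \/ a = p w -> b = w \/ b = p w -> a = b \/ a = p b.
  by move=> Dw [] -> [] ->; rewrite ?pp; auto.
have [lt12|[x2v1 v2x1]] := exit_reverse E1 (cls _ _ _ Du2 hx2 hv1) E2.
  have [lt21|[x1v2 v1x2]] := exit_reverse E2 (cls _ _ _ Du1 hx1 hv2) E1.
    by have := lt_trans lt12 lt21; rewrite ltxx.
  by rewrite x1v2 v1x2 edistC ltxx in lt12.
subst v1 v2; have g1 := g_exit E1.
have inA z : A z -> D z -> (z = u1 \/ z = p u1) \/ (z = u2 \/ z = p u2).
  by rewrite AE => -[Az|Az] Dz; [left; exact: A1m|right; exact: A2m].
have T1 : terminal x1 by exists x2.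
exists x1; split.
- by rewrite AE; left; case: hx1 => ->.
- by rewrite AE g1; right; case: hx2 => ->.
- exact/head_terminal.
move=> y Ay /head_terminal[v [Eyv _]]; have Dy : D y by case: Eyv.
rewrite g1; case: (inA _ Ay Dy) => hy; [left|right].
- exact: (exit_class E1 Eyv (cls _ _ _ Du1 hy hx1)).
- exact: (exit_class E2 Eyv (cls _ _ _ Du2 hy hx2)).
Qed.

End Step.

Section Construction.
Variable S : set point.
Hypothesis ties : no_ties S.
Hypothesis lfin : locally_finite S.
Hypothesis scales : forall k N0, scale S k N0.

Lemma level_init : level S S id id.
Proof.
split=> // [x Sx|x Sx|x y _ _ yx _]; first by exists 0%N.
  apply: sub_finite_set (finite_set1 x) => z [_ [m <-]].
  by elim: m => //= m ->.
by rewrite edistxx edist_gt0 // => /esym.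
Qed.

Lemma block_single_init : block_single S S id 0.
Proof. by move=> A [a Sa ->]; exists a; split=> // y -> _; left. Qed.

Lemma exits_nn_rel x v : S x -> exits S id x v <-> nn_rel S x v.
Proof.
move=> Sx; split=> [[_ Sv vx _ m]|[Sv [vx m]]].
  split=> //; split=> // z Sz zx zv; apply: m => //; first by left.
  by case.
split=> // u' v' [] -> Sv' v'x _ neq; apply: m => // e; apply: neq; by rewrite e.
Qed.

Lemma f0_exit x v : exits S id x v -> f0 S x = v.
Proof.
move=> Exv; have Sx : S x by case: Exv.
have Ev := proj1 (exits_nn_rel v Sx) Exv.
apply: xget_unique => // y /(exits_nn_rel y Sx) Exy.
exact: (exit_fun Exy Exv).
Qed.

Lemma f0_same x : S x -> (forall v, ~ exits S id x v) -> f0 S x = id x.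
Proof. by move=> Sx nE; apply: xgetPN => v /(exits_nn_rel v Sx); exact: nE. Qed.

Lemma next_shift_exit f x v : exits (head S f) f x v -> next_shift S f x = v.
Proof. by move=> Exv; apply: xget_unique => // y Exy; exact: (exit_fun Exy Exv). Qed.

Lemma next_shift_same f x : S x -> (forall v, ~ exits (head S f) f x v) ->
  next_shift S f x = f x.
Proof. by move=> _ nE; apply: xgetPN => v; exact: nE. Qed.

Lemma chn_levels n : [/\ level S (head S (chn S n)) (chn S n) (chn S n),
  block_single S (head S (chn S n)) (chn S n) n.+1 & good_level S (chn S n)].
Proof.
elim: n => [|n [lev blk _]].
  split.
  - exact: (next_level ties lfin (scales 0) level_init block_single_init f0_exit f0_same).
  - exact: (next_block ties lfin (scales 0) level_init block_single_init f0_exit f0_same).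
  - exact: (next_good ties lfin (scales 0) level_init block_single_init f0_exit f0_same).
have ne := @next_shift_exit (chn S n); have ns := @next_shift_same (chn S n).
split.
- exact: (next_level ties lfin (scales n.+1) lev blk ne ns).
- exact: (next_block ties lfin (scales n.+1) lev blk ne ns).
- exact: (next_good ties lfin (scales n.+1) lev blk ne ns).
Qed.

Theorem chn_well_defined n : chn_wd S n /\ good_level S (chn S n).
Proof.
split; last by case: (chn_levels n).
split=> [x Sx|k _].
  have [u [v [hu Euv]]] :=
    exit_exists ties lfin (scales 0) level_init block_single_init Sx.
  have ux : u = x by case: hu.
  by exists v; apply/exits_nn_rel => //; rewrite -ux.
have [lev blk good] := chn_levels k; split=> // a ha.
exact: (exit_exists ties lfin (scales k.+1) lev blk ha).
Qed.

End Construction.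
End Clusters.

(** * Cells of a Poisson process *)

Section OuterBounds.
Variables (R : realType) (d0 : measure_display) (T : measurableType d0).
Variable P : probability T R.
Implicit Types A B : set T.

Definition pbound A (e : R) :=
  exists B, [/\ measurable B, A `<=` B & (P B <= e%:E)%E].

Lemma pboundS A B e e' : A `<=` B -> e <= e' -> pbound B e -> pbound A e'.
Proof.
move=> AB ee' [C [mC BC PC]]; exists C; split=> //; first exact: subset_trans BC.
by rewrite (le_trans PC) // lee_fin.
Qed.

Lemma pbound_set0 A e : (forall w, ~ A w) -> 0 <= e -> pbound A e.
Proof.
move=> A0 e0; exists set0; split=> //; by rewrite measure0 lee_fin.
Qed.

Lemma pboundU A B a b : pbound A a -> pbound B b -> pbound (A `|` B) (a + b).
Proof.
move=> [A' [mA AA' PA]] [B' [mB BB' PB]]; exists (A' `|` B'); split.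
- exact: measurableU.
- exact: setUSS.
- by rewrite (le_trans (measureU2 P mA mB)) // EFinD leeD.
Qed.

Lemma pbound_exists (I : eqType) (s : seq I) (A : I -> set T) (e : I -> R) :
  (forall i, i \in s -> pbound (A i) (e i)) ->
  pbound [set w | exists2 i, i \in s & A i w] (\sum_(i <- s) e i).
Proof.
elim: s => [|i s IH] h; first by rewrite big_nil; apply: pbound_set0 => // w [].
rewrite big_cons; apply: pboundS (lexx _) (pboundU (h i _) (IH _)).
- move=> w [j]; rewrite inE => /orP[/eqP->|js] Aj; first by left.
  by right; exists j.
- exact: mem_head.
- by move=> j js; apply: h; rewrite inE js orbT.
Qed.

Lemma pbound_negligible A : (forall e, 0 < e -> pbound A e) -> P.-negligible A.
Proof.
move=> h; have h' n : pbound A (n.+1%:R^-1) by apply: h; rewrite invr_gt0.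
have /choice[B hB] : forall n, exists B,
    [/\ measurable B, A `<=` B & (P B <= (n.+1%:R^-1)%:E)%E] by [].
exists (\bigcap_n B n); split.
- by apply: bigcap_measurableType => n _; case: (hB n).
- apply/eqP; rewrite eq_le measure_ge0 andbT; apply/lee_addgt0Pr => e e0.
  rewrite add0e.
  have [n ne] : exists n : nat, n.+1%:R^-1 <= e.
    exists (Num.Def.archi_bound e^-1).
    rewrite invf_ple ?posrE // (le_trans (ltW (archi_boundP _))) ?invr_ge0 ?ltW //.
    by rewrite ltr_nat.
  have [mB _ PB] := hB n; apply: (@le_trans _ _ (P (B n))).
    apply: le_measure; rewrite ?inE //.
    - by apply: bigcap_measurableType => i _; case: (hB i).
    - exact: bigcap_inf.
  by rewrite (le_trans PB) // lee_fin.
- by move=> w Aw n _; have [_ AB _] := hB n; exact: AB.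
Qed.

Definition inter (I : eqType) (s : seq I) (A : I -> set T) : set T :=
  [set w | forall i, i \in s -> A i w].

Lemma inter_measurable (I : eqType) (s : seq I) (A : I -> set T) :
  (forall i, measurable (A i)) -> measurable (inter s A).
Proof.
move=> mA; have -> : inter s A = \bigcap_(i in [set` s]) A i by [].
by apply: fin_bigcap_measurable => // i _; exact: mA.
Qed.

Lemma inter_nil (I : eqType) (A : I -> set T) : inter [::] A = setT.
Proof. by apply/seteqP; split=> w. Qed.

Lemma inter_cons (I : eqType) i (s : seq I) (A : I -> set T) :
  inter (i :: s) A = A i `&` inter s A.
Proof.
apply/seteqP; split=> w /=.
  by move=> h; split; [apply: h; rewrite mem_head|move=> j js; apply: h; rewrite inE js orbT].
by move=> [Ai h] j; rewrite inE => /orP[/eqP->//|/h].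
Qed.

Lemma inter_compl (I : eqType) (A : I -> set T) (pr : I -> R) (t s : seq I) :
  (forall i, measurable (A i)) ->
  (forall s, uniq s -> P (inter s A) = (\prod_(i <- s) pr i)%:E) ->
  uniq (s ++ t) ->
  P (inter t A `&` inter s (fun i => ~` A i)) =
    ((\prod_(i <- t) pr i) * \prod_(i <- s) (1 - pr i))%:E.
Proof.
move=> mA hA; elim: s t => [|i s IH] t ust.
  by rewrite big_nil mulr1 inter_nil setIT hA.
have [/= nit ut] := andP ust.
have uit : uniq (s ++ i :: t) by rewrite -cat1s uniq_catCA.
have msC : measurable (inter s (fun i => ~` A i)).
  by apply: inter_measurable => j; apply: measurableC.
have mts := measurableI _ _ (inter_measurable t mA) msC.
have -> : inter t A `&` inter (i :: s) (fun i => ~` A i) =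
    (inter t A `&` inter s (fun i => ~` A i)) `\` A i.
  by rewrite inter_cons setDE setICA setIC.
have -> : P ((inter t A `&` inter s (fun i => ~` A i)) `\` A i) =
    (P (inter t A `&` inter s (fun i => ~` A i)) -
     P (inter t A `&` inter s (fun i => ~` A i) `&` A i))%E.
  by apply: measureD => //; rewrite -ge0_fin_numE ?fin_num_measure.
have -> : inter t A `&` inter s (fun i => ~` A i) `&` A i =
    inter (i :: t) A `&` inter s (fun i => ~` A i).
  by rewrite inter_cons setIAC [A i `&` _]setIC.
by rewrite !IH // !big_cons -EFinB; congr (_%:E); ring.
Qed.

End OuterBounds.

Section Cells.
Variables (R : realType) (d : nat).
Notation point := 'rV[R]_d.
Notation idx := {ffun 'I_d -> int}.

Definition cell (H : nat) (z : idx) : set point :=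
  box (\row_i ((z i)%:~R / H%:R)) (\row_i ((z i + 1)%:~R / H%:R)).

Definition cidx (H : nat) (x : point) : idx :=
  [ffun i => Num.floor (H%:R * x ord0 i)].

Lemma cellP H z x : (0 < H)%N -> cell H z x <-> cidx H x = z.
Proof.
move=> H0; have H0' : (0 : R) < H%:R by rewrite ltr0n.
split=> [h|<- i]; last first.
  by rewrite !mxE ler_pdivrMr // ltr_pdivlMr // mulrC ffunE floor_itv.
apply/ffunP => i; rewrite ffunE; apply: floor_def.
by have := h i; rewrite !mxE ler_pdivrMr // ltr_pdivlMr // mulrC.
Qed.

Lemma cell_disjoint H z z' : (0 < H)%N -> z <> z' -> cell H z `&` cell H z' = set0.
Proof.
move=> H0 zz'; rewrite -subset0 => x [/(cellP _ _ H0) zx /(cellP _ _ H0) zx'].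
by apply: zz'; rewrite -zx.
Qed.

Lemma cell_vol H (z : idx) : (0 < H)%N ->
  box_vol (\row_i ((z i)%:~R / H%:R)) (\row_i ((z i + 1)%:~R / H%:R)) =
  H%:R ^- d :> R.
Proof.
move=> H0; rewrite /box_vol (eq_bigr (fun=> H%:R^-1)); last first.
  by move=> i _; rewrite !mxE intrD -mulrBl addrC addKr mul1r.
by rewrite prodr_const card_ord exprVn.
Qed.

End Cells.

Section Poisson.
Variables (R : realType) (d : nat) (d0 : measure_display) (T : measurableType d0).
Variables (P : probability T R) (lam : R) (Phi : T -> set 'rV[R]_d).
Hypothesis hP : is_hPPP P lam Phi.
Notation point := 'rV[R]_d.
Notation idx := {ffun 'I_d -> int}.

Lemma cell_counts H (s : seq idx) (k : idx -> nat) : (0 < H)%N -> uniq s ->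
  P (inter s (fun z => count_eq Phi (cell H z) (k z))) =
  (\prod_(z <- s) poisson_pmf (lam / H%:R ^+ d) (k z))%:E.
Proof.
move=> H0 us; have [_ [_ hj]] := hP.
pose z_ := tnth (in_tuple s).
have := hj (size s) (fun i => \row_j ((z_ i j)%:~R / H%:R))
  (fun i => \row_j ((z_ i j + 1)%:~R / H%:R)) (fun i => k (z_ i)).
have -> : \bigcap_(i in [set: 'I_(size s)]) count_eq Phi
    (box (\row_j ((z_ i j)%:~R / H%:R)) (\row_j ((z_ i j + 1)%:~R / H%:R))) (k (z_ i)) =
    inter s (fun z => count_eq Phi (cell H z) (k z)).
  apply/seteqP; split=> w h.
    by move=> z /(tnthP (in_tuple s)) [i ->]; exact: h.
  by move=> i _; apply: h; exact: (mem_tnth i (in_tuple s)).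
move=> ->.
- rewrite big_tnth; congr (_%:E); apply: eq_bigr => i _.
  by rewrite cell_vol.
- move=> i c; rewrite !mxE ler_pM2r ?invr_gt0 ?ltr0n // ler_int; lia.
- move=> i j ij; apply: cell_disjoint => // zij; apply: ij.
  apply: val_inj; apply/eqP; have x0 := z_ i.
  rewrite -(nth_uniq x0 (ltn_ord i) (ltn_ord j) us).
  by apply/eqP; move: zij; rewrite /z_ !(tnth_nth x0).
Qed.

Lemma count_measurable H z k : measurable (count_eq Phi (@cell R d H z) k).
Proof. by have [_ [h _]] := hP; exact: h. Qed.

Lemma count0P (B : set point) w : count_eq Phi B 0 w <-> (forall x, Phi w x -> ~ B x).
Proof.
split=> [[s [_ /size0nil -> h]] x Px Bx|h].
  by have : (Phi w `&` B) x by []; rewrite h.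
exists [::]; split=> //; apply/seteqP; split=> x //= [Px Bx].
by case: (h x Px Bx).
Qed.

Lemma count1P (B : set point) w : count_eq Phi B 1 w <->
  exists x, Phi w `&` B = [set x].
Proof.
split=> [[s [us ss h]]|[x h]].
  move: s us ss h => [//|x [|//]] _ _ h; exists x; rewrite h.
  by apply/seteqP; split=> y /=; rewrite inE; move/eqP.
exists [:: x]; split=> //; rewrite h.
by apply/seteqP; split=> y /=; rewrite inE; move/eqP.
Qed.

Definition occ H (z : idx) : set T := ~` count_eq Phi (cell H z) 0.

Lemma occP H w x : (0 < H)%N -> Phi w x -> occ H (cidx H x) w.
Proof.
by move=> H0 Px /count0P /(_ x Px); apply; apply/cellP.
Qed.

Lemma Phi_locally_finite w : locally_finite (Phi w).
Proof.
move=> r; have [h _] := hP.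
apply: sub_finite_set (h w (\row_i (- r - 1)) (\row_i (r + 1))) => x [Px xr].
split=> // i; rewrite !mxE; have := edist_coord 0 x i; rewrite mxE sub0r normrN.
move: xr => /= xr; rewrite ler_norml => /andP[]; lra.
Qed.

Local Notation q H := (lam / H%:R ^+ d).
Hypothesis lam0 : 0 < lam.

Lemma q_ge0 H : 0 <= q H.
Proof. by rewrite divr_ge0 ?exprn_ge0 // ltW. Qed.

Lemma pbound_occ H s : (0 < H)%N -> uniq s ->
  pbound P (inter s (occ H)) (q H ^+ size s).
Proof.
move=> H0 us; exists (inter s (occ H)); split=> //.
  by apply: inter_measurable => z; apply: measurableC; exact: count_measurable.
have := @inter_compl _ _ _ P _ (fun z => count_eq Phi (cell H z) 0)
  (fun=> poisson_pmf (q H) 0) [::] s.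
rewrite inter_nil setTI big_nil mul1r cats0 => -> //; last 2 first.
- by move=> z; exact: count_measurable.
- by move=> s' us'; rewrite (cell_counts (fun=> 0%N)).
rewrite lee_fin; elim: s us => [|z s IH]; first by rewrite big_nil.
move=> /= /andP[_ us]; rewrite big_cons exprS.
have e1 : poisson_pmf (q H) 0 = expR (- q H).
  by rewrite /poisson_pmf expr0 mulr1 fact0 divr1.
have le1 : 1 - poisson_pmf (q H) 0 <= q H.
  by rewrite e1; have := expR_ge1Dx (- q H); lra.
have ge1 : 0 <= 1 - poisson_pmf (q H) 0.
  by rewrite e1 subr_ge0 expR_le1 oppr_le0 q_ge0.
apply: ler_pM => //; last exact: IH.
by apply: prodr_ge0.
Qed.

Lemma pbound_double H z : (0 < H)%N ->
  pbound P [set w | exists x y, [/\ Phi w x, Phi w y, cell H z x, cell H z y & x <> y]]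
    (q H ^+ 2).
Proof.
move=> H0; set C0 := count_eq Phi (@cell R d H z) 0.
set C1 := count_eq Phi (@cell R d H z) 1.
have m0 : measurable C0 by exact: count_measurable.
have m1 : measurable C1 by exact: count_measurable.
have PC k : P (count_eq Phi (@cell R d H z) k) = (poisson_pmf (q H) k)%:E.
  have := @cell_counts H [:: z] (fun=> k) H0 isT; rewrite big_seq1 => <-.
  by rewrite inter_cons inter_nil setIT.
exists (~` (C0 `|` C1)); split.
- exact/measurableC/measurableU.
- move=> w [x [y [Px Py zx zy xy]]] [/count0P/(_ x Px)|/count1P[a Ha]]; first exact.
  have hx : (Phi w `&` cell H z) x by []. have hy : (Phi w `&` cell H z) y by [].
  by rewrite Ha in hx hy; apply: xy; rewrite hx hy.
have dis : C0 `&` C1 = set0.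
  rewrite -subset0 => w [/count0P h /count1P[a Ha]].
  have [] : (Phi w `&` cell H z) a by rewrite Ha.
  by move=> Pa za; exact: (h a Pa).
rewrite probability_setC; last exact: measurableU.
have -> : P (C0 `|` C1) = (poisson_pmf (q H) 0 + poisson_pmf (q H) 1)%:E.
  rewrite measureU // EFinD; congr (_ + _)%E; exact: PC.
rewrite -EFinB lee_fin /poisson_pmf expr0 expr1 fact0 !divr1 mulr1.
have := expR_ge1Dx (- q H); have := q_ge0 H.
by set a := q H; set b := expR _; nra.
Qed.

End Poisson.

Section Lattice.
Variable d : nat.
Notation idx := {ffun 'I_d -> int}.

Definition nbr (z : idx) (r : nat) : seq idx :=
  [seq [ffun i => z i + (c i : nat)%:Z - r%:Z] |
     c : {ffun 'I_d -> 'I_(r.*2.+1)} <- enum {: {ffun 'I_d -> 'I_(r.*2.+1)}}].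

Definition sqd (z z' : idx) : int := \sum_i (z i - z' i) ^+ 2.

Lemma size_nbr z r : size (nbr z r) = (r.*2.+1 ^ d)%N.
Proof. by rewrite size_map -cardE card_ffun !card_ord. Qed.

Lemma nbr_uniq z r : uniq (nbr z r).
Proof.
rewrite map_inj_uniq ?enum_uniq // => c c' /ffunP h.
apply/ffunP => i; apply: val_inj => /=; have := h i; rewrite !ffunE; lia.
Qed.

Lemma mem_nbr z r z' : (z' \in nbr z r) = [forall i, `|z' i - z i| <= r%:Z].
Proof.
apply/mapP/forallP => [[c _ ->] i|h].
  by rewrite ffunE ler_norml; have := ltn_ord (c i); move: (c i) => ci; lia.
pose c := [ffun i => inord (absz (z' i - z i + r%:Z)) : 'I_(r.*2.+1)].
exists c; first by rewrite mem_enum.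
apply/ffunP => i; by rewrite !ffunE inordK; have := h i; rewrite ler_norml; lia.
Qed.

Lemma nbr_shift z r : nbr z r = [seq z + v | v <- nbr 0 r].
Proof.
rewrite -map_comp; apply: eq_map => c /=; apply/ffunP => i.
by rewrite !ffunE; ring.
Qed.

End Lattice.

Lemma card_window (W g : nat) (p : pred 'I_W) :
  (forall t t', p t -> p t' -> t <= t' -> t' <= t + g)%N -> (#|p| <= g.+1)%N.
Proof.
move=> pg; have [t0 pt0|p0] := pickP p; last by rewrite eq_card0.
have [tm ptm tmin] : exists2 t, p t & forall t', p t' -> (t <= t')%N.
  by have [t pt tm] := @arg_minnP _ t0 p (fun t => t : nat) pt0; exists t.
have : p \subset [pred t : 'I_W | (tm <= t < tm + g.+1)%N].
  apply/fintype.subsetP => t pt; rewrite inE tmin //= addnS ltnS; exact: pg (tmin _ pt).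
move=> /subset_leq_card /leq_trans; apply.
rewrite cardE -(size_map val); apply: (@leq_trans (size (iota tm g.+1))).
  apply: uniq_leq_size.
    by rewrite map_inj_uniq ?enum_uniq //; exact: val_inj.
  move=> j /mapP[t]; by rewrite mem_enum inE => h ->; rewrite mem_iota.
by rewrite size_iota.
Qed.

Lemma card_square_window (r g : nat) (a : int) :
  (#|[pred t : 'I_(r.*2.+1) |
      (a <= ((t : nat)%:Z - r%:Z) ^+ 2 <= a + (g ^ 2)%N%:Z)%R]| <= 2 * g.+1)%N.
Proof.
set p := [pred t | _].
have pP (t : 'I_(r.*2.+1)) : p t -> a <= ((t : nat)%:Z - r%:Z) ^+ 2 <= a + g%:Z ^+ 2.
  by rewrite /p /= -mulnn PoszM -expr2.
pose p1 := [pred t : 'I_(r.*2.+1) | p t && (r <= t)%N].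
pose p2 := [pred t : 'I_(r.*2.+1) | p t && (t < r)%N].
have -> : #|p| = (#|p1| + #|p2|)%N.
  rewrite -(cardID [pred t : 'I__ | (r <= t)%N] p); congr (_ + _)%N; apply: eq_card => t.
  by rewrite !inE -ltnNge andbC.
have -> : (2 * g.+1 = g.+1 + g.+1)%N by lia.
apply: leq_add.
  apply: card_window => t t' /andP[/pP h rt] /andP[/pP h' rt'] le_t.
  suff : (t' : nat)%:Z - (t : nat)%:Z <= g%:Z by lia.
  by nia.
apply: card_window => t t' /andP[/pP h rt] /andP[/pP h' rt'] le_t.
suff : (t' : nat)%:Z - (t : nat)%:Z <= g%:Z by lia.
by nia.
Qed.

Lemma annulus_size d (z : {ffun 'I_d.+1 -> int}) (r g : nat) (a : int) :
  (size [seq c <- nbr z r | (a <= sqd c z <= a + (g ^ 2)%N%:Z)%R] <=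
     r.*2.+1 ^ d * (2 * g.+1))%N.
Proof.
rewrite size_filter count_map -sum1_count big_enum_cond /=.
pose rest (c : {ffun 'I_d.+1 -> 'I_(r.*2.+1)}) := [ffun j : 'I_d => c (lift ord0 j)].
rewrite (partition_big rest predT) //=.
apply: (@leq_trans (\sum_(c' : {ffun 'I_d -> 'I_(r.*2.+1)}) 2 * g.+1)); last first.
  by rewrite sum_nat_const card_ffun !card_ord.
apply: leq_sum => c' _; rewrite sum1_card.
pose b : int := \sum_(j < d) ((c' j : nat)%:Z - r%:Z) ^+ 2.
apply: leq_trans (card_square_window r g (a - b)).
rewrite -(card_in_imset (f := fun c : {ffun 'I_d.+1 -> 'I_(r.*2.+1)} => c ord0)).
  apply/subset_leq_card/fintype.subsetP => t /imsetP[c]; rewrite inE => /andP[h /eqP rc] ->.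
  move: h; rewrite /= /sqd big_ord_recl.
  have -> : \sum_(i < d) ([ffun i => z i + (c i : nat)%:Z - r%:Z] (lift ord0 i) -
     z (lift ord0 i)) ^+ 2 = b.
    by apply: eq_bigr => j _; rewrite -rc !ffunE; congr (_ ^+ 2); ring.
  rewrite ffunE; have -> : z ord0 + (c ord0 : nat)%:Z - r%:Z - z ord0 =
    (c ord0 : nat)%:Z - r%:Z by ring.
  by move=> /andP[h1 h2]; apply/andP; split; lra.
move=> c1 c2 /andP[_ /eqP r1] /andP[_ /eqP r2] c0.
apply/ffunP => i; case: (unliftP ord0 i) => [j ->|-> //].
by move: r1; rewrite -r2 => /ffunP /(_ j); rewrite !ffunE.
Qed.

(** * Absence of ties *)

Section Discretization.
Variables (R : realType) (d : nat).
Notation point := 'rV[R]_d.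

Lemma cidx0 H : cidx H (0 : point) = 0.
Proof. by apply/ffunP => i; rewrite !ffunE mxE mulr0 floor0. Qed.

Lemma cidx_coord H (x y : point) (L : R) i : edist x y <= L ->
  [/\ `|H%:R * x ord0 i - H%:R * y ord0 i| <= H%:R * L,
      `|(cidx H x i - cidx H y i)%:~R - (H%:R * x ord0 i - H%:R * y ord0 i)| <= 1 &
      `|(cidx H x i - cidx H y i)%:~R| < H%:R * L + 1].
Proof.
move=> xyL; have h1 : `|H%:R * x ord0 i - H%:R * y ord0 i| <= H%:R * L.
  rewrite -mulrBr normrM ger0_norm // ler_wpM2l //.
  exact: le_trans (edist_coord _ _ _) xyL.
rewrite !ffunE intrB; have := floor_itv (H%:R * x ord0 i).
have := floor_itv (H%:R * y ord0 i); rewrite !intrD.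
set a := _%:~R; set b := _%:~R; move=> /andP[b1 b2] /andP[a1 a2].
split=> //.
  by rewrite ler_norml; apply/andP; split; lra.
by move: h1; rewrite ler_norml ltr_norml => /andP[? ?]; apply/andP; split; lra.
Qed.

Lemma cidx_near H (x y : point) (L : nat) : edist x y <= L%:R ->
  cidx H y \in nbr (cidx H x) (H * L).
Proof.
move=> xyL; rewrite mem_nbr; apply/forallP => i.
rewrite edistC in xyL; have [_ _] := cidx_coord H i xyL.
rewrite -intr_norm -natrM -[1]/(1%:R) -natrD -[(_ + _)%:R]/((H * L + 1)%N%:Z%:~R).
by rewrite ltr_int PoszD ltzD1.
Qed.

Lemma sqd_near H (x y : point) (L : nat) : edist x y <= L%:R ->
  `|(sqd (cidx H y) (cidx H x))%:~R - (H%:R * edist x y) ^+ 2| <=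
     (d * (2 * (H * L)))%N%:R :> R.
Proof.
move=> xyL; rewrite exprMn sqr_edist mulr_sumr /sqd rmorph_sum /= -sumrB.
rewrite (le_trans (ler_norm_sum _ _ _)) //.
have -> : (d * (2 * (H * L)))%N%:R = \sum_(i < d) (2 * (H * L))%N%:R :> R.
  by rewrite sumr_const card_ord natrM mulr_natl.
apply: ler_sum => i _; have [h1 h2 _] := cidx_coord H i xyL.
have h3 : `|(cidx H x i - cidx H y i)%:~R| <= (H * L)%N%:R :> R.
  have := cidx_near H xyL; rewrite mem_nbr => /forallP/(_ i).
  by rewrite distrC -[(_ * _)%N%:R]/((H * L)%N%:Z%:~R) -intr_norm ler_int.
rewrite -natrM in h1.
rewrite rmorphXn /= -[(cidx H y i - _)]opprB rmorphN sqrrN -exprMn mulrBr subr_sqr.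
rewrite normrM natrM -[X in _ <= X]mul1r.
apply: ler_pM => //; rewrite (le_trans (ler_normD _ _)) //; lra.
Qed.

End Discretization.

Section Ties.
Variables (R : realType) (d' : nat) (d0 : measure_display) (T : measurableType d0).
Notation d := d'.+1.
Variables (P : probability T R) (lam : R) (Phi : T -> set 'rV[R]_d).
Hypothesis lam0 : 0 < lam.
Hypothesis hP : is_hPPP P lam Phi.
Notation point := 'rV[R]_d.
Notation idx := {ffun 'I_d -> int}.
Local Notation q H := (lam / H%:R ^+ d).
Local Notation occ := (occ Phi).

Let q0 H : 0 <= q H := q_ge0 d lam0 H.

Lemma q_mul_le (H A B : nat) : (0 < H)%N -> (A <= H ^ d * B)%N ->
  q H * A%:R <= lam * B%:R.
Proof.
move=> H0 AB; have Hd : (0 : R) < H%:R ^+ d by rewrite exprn_gt0 ?ltr0n.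
rewrite mulrAC ler_pdivrMr // -mulrA ler_pM2l // -natrX -natrM ler_nat.
by rewrite mulnC.
Qed.

Lemma q_nbr_le H M (z : idx) : (0 < H)%N ->
  q H * (size (nbr z (H * M)))%:R <= lam * ((2 * M + 1) ^ d)%N%:R.
Proof.
move=> H0; apply: q_mul_le => //; rewrite size_nbr -expnMn leq_exp2r //.
by rewrite -mul2n; lia.
Qed.

Definition bad_cells H N : set T := occ H 0 `|`
  [set w | exists2 z, z \in nbr (0 : idx) (H * N) & exists x y,
     [/\ Phi w x, Phi w y, cell H z x, cell H z y & x <> y]].

Lemma bad_cells_bound H N : (0 < H)%N ->
  pbound P (bad_cells H N) (q H * (1 + lam * ((2 * N + 1) ^ d)%N%:R)).
Proof.
move=> H0; have h1 := pbound_occ hP lam0 (s := [:: 0]) H0 isT.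
have h2 := @pbound_exists _ _ _ P _ (nbr (0 : idx) (H * N)) _ _
  (fun z _ => pbound_double hP lam0 z H0).
apply: (pboundS _ _ (pboundU h1 h2)).
  move=> w [hw | hw]; [left|by right].
  by move=> z; rewrite inE => /eqP->.
rewrite big_const_seq count_predT iter_addr_0 expr1 mulrDr mulr1 lerD2l.
rewrite -[X in X <= _]mulr_natr expr2 -mulrA ler_wpM2l //; exact: q_nbr_le.
Qed.

Section GoodCells.
Variables (H N : nat) (w : T) (Z : set point).
Hypotheses (H0 : (0 < H)%N) (Z0 : Z `<=` [set 0]) (good : ~ bad_cells H N w).
Local Notation S := (Phi w `|` Z).

Lemma good_cell0 x : S x -> x <> 0 -> cidx H x <> 0.
Proof.
move=> [Px|/Z0 //] x0 cx; apply: good; left; rewrite -cx.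
exact: occP.
Qed.

Lemma good_cell_inj x y : S x -> S y -> edist 0 x <= N%:R -> x <> y ->
  cidx H x <> cidx H y.
Proof.
move=> Sx Sy xN xy cxy.
have [x0|/eqP x0] := eqVneq x 0.
  apply: (@good_cell0 y Sy); last by rewrite -cxy x0 cidx0.
  by move=> y0; apply: xy; rewrite x0 y0.
have [y0|/eqP y0] := eqVneq y 0.
  by apply: (@good_cell0 x Sx) => //; rewrite cxy y0 cidx0.
have Px : Phi w x by case: Sx => // /Z0.
have Py : Phi w y by case: Sy => // /Z0.
apply: good; right; exists (cidx H x).
  by have := cidx_near H xN; rewrite cidx0.
by exists x, y; split=> //; apply/cellP.
Qed.

End GoodCells.

Definition wt H (s : seq idx) : R := q H ^+ size (undup [seq z <- s | z != 0]).

Definition occ0 H (z : idx) : set T := [set w | z = 0 \/ occ H z w].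

Lemma pbound_occ0 H s : (0 < H)%N -> pbound P (inter s (occ0 H)) (wt H s).
Proof.
move=> H0; apply: (pboundS _ (lexx _) (pbound_occ hP lam0 H0 (undup_uniq _))).
move=> w h z; rewrite mem_undup mem_filter => /andP[/eqP z0 zs].
by case: (h z zs).
Qed.

Lemma wt_ge0 H s : 0 <= wt H s.
Proof. by rewrite exprn_ge0. Qed.

Lemma wt_cons H c s :
  wt H (c :: s) = (if c \in 0 :: s then 1 else q H) * wt H s.
Proof.
rewrite /wt /= inE; have [->|c0] /= := eqVneq c 0; first by rewrite mul1r.
rewrite mem_filter c0 /=; case: ifP => _; first by rewrite mul1r.
by rewrite /= exprS.
Qed.

Lemma wt_sum H (B s : seq idx) : uniq B ->
  \sum_(c <- B) wt H (c :: s) <= ((size s).+1%:R + q H * (size B)%:R) * wt H s.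
Proof.
move=> uB; rewrite (eq_bigr _ (fun c _ => wt_cons H c s)) -mulr_suml.
rewrite ler_wpM2r ?wt_ge0 //.
apply: (@le_trans _ _ (\sum_(c <- B) ((c \in 0 :: s)%:R + q H))).
  by apply: ler_sum => c _; case: ifP => _; rewrite ?lerDl //= add0r.
rewrite big_split /= big_const_seq count_predT iter_addr_0 mulr_natr lerD2r.
rewrite -natr_sum ler_nat.
have -> : (\sum_(c <- B) (c \in 0%R :: s) = count (mem (0%R :: s)) B)%N.
  by rewrite -sum1_count [RHS]big_mkcond; apply: eq_bigr => c _ /=; case: (_ \in _).
rewrite -size_filter -[(size s).+1]/(size (0%R :: s)).
apply: uniq_leq_size; first exact: filter_uniq.
by move=> c; rewrite mem_filter => /andP[].
Qed.

Definition tied_cells H N : set T := [set w |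
  exists2 cx, cx \in nbr (0 : idx) (H * N) &
  exists2 cu, cu \in nbr (0 : idx) (H * N) &
  exists2 cv, cv \in nbr (0 : idx) (H * N) &
  exists2 cy, cy \in [seq c <- nbr cx (H * (2 * N)) |
      let e := (d * (2 * (H * (2 * N))))%N%:Z in
      sqd cv cu - 2 * e <= sqd c cx <= sqd cv cu + 2 * e] &
  cy \notin [:: 0; cx; cu; cv] /\ inter [:: cy; cx; cu; cv] (occ0 H) w].

Lemma tied_cells_bound h N : (0 < h)%N ->
  let K := lam * ((2 * N + 1) ^ d)%N%:R in
  pbound P (tied_cells (h ^ 2) N) ((1 + K) * ((2 + K) * ((3 + K) *
    (lam * (((4 * N + 1) ^ d') * (2 * (16 * d * N + 1)))%N%:R / h%:R)))).
Proof.
move=> h0 K; set H := (h ^ 2)%N; have H0 : (0 < H)%N by rewrite expn_gt0 h0.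
set C := lam * _ / _.
have K0 : 0 <= K by rewrite mulr_ge0 // ltW.
have C0 : 0 <= C by rewrite !mulr_ge0 ?invr_ge0 // ltW.
have sumB (s : seq idx) (b : R) : 0 <= b ->
    \sum_(c <- nbr (0 : idx) (H * N)) wt H (c :: s) * b <=
      wt H s * (((size s).+1%:R + K) * b).
  move=> b0; rewrite -mulr_suml mulrA ler_wpM2r // mulrC.
  apply: le_trans (wt_sum H s (nbr_uniq _ _)) _; rewrite ler_wpM2r ?wt_ge0 //.
  by rewrite lerD2l; exact: q_nbr_le.
have last_ cx cu cv : pbound P [set w |
    exists2 cy, cy \in [seq c <- nbr cx (H * (2 * N)) |
      let e := (d * (2 * (H * (2 * N))))%N%:Z in
      sqd cv cu - 2 * e <= sqd c cx <= sqd cv cu + 2 * e] &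
    cy \notin [:: 0; cx; cu; cv] /\ inter [:: cy; cx; cu; cv] (occ0 H) w]
    (wt H [:: cv; cu; cx] * C).
  set l := [seq c <- _ | _].
  apply: (pboundS (@subset_refl _ _) _ (@pbound_exists _ _ _ P _ l
    (fun cy => [set w | cy \notin [:: 0; cx; cu; cv] /\
        inter [:: cy; cx; cu; cv] (occ0 H) w])
    (fun=> q H * wt H [:: cv; cu; cx]) _)); last first.
    move=> cy _; have [cyin|cyn] := boolP (cy \in [:: 0; cx; cu; cv]).
      apply: pbound_set0; first by move=> w [/negP].
      by rewrite mulr_ge0 ?wt_ge0.
    have -> : q H * wt H [:: cv; cu; cx] = wt H [:: cy; cv; cu; cx].
      rewrite [RHS]wt_cons ifN //; move: cyn; rewrite !inE !negb_or.
      by move=> /and4P[n0 nx nu nv]; apply/and4P.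
    apply: pboundS (lexx _) (pbound_occ0 [:: cy; cv; cu; cx] H0) => w [_ hw] z zs.
    by apply: hw; move: zs; rewrite !inE => /or4P[]->; rewrite ?orbT.
  rewrite big_const_seq count_predT iter_addr_0 -[X in X <= _]mulr_natr mulrAC mulrC.
  rewrite ler_wpM2l ?wt_ge0 // /C.
  have szl : (size l <= H ^ d' * ((4 * N + 1) ^ d' * (2 * (16 * d * N + 1))) * h)%N.
    pose a := sqd cv cu - 2 * (d * (2 * (H * (2 * N))))%N%:Z.
    apply: (@leq_trans (size [seq c <- nbr cx (H * (2 * N)) |
        a <= sqd c cx <= a + ((16 * d * N * h) ^ 2)%N%:Z])).
      rewrite !size_filter; apply: sub_count => c /= /andP[h1 h2].
      rewrite h1 /= (le_trans h2) // /a.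
      suff : (4 * (d * (2 * (H * (2 * N)))) <= (16 * d * N * h) ^ 2)%N.
        by move: (d * _)%N ((_ ^ 2)%N) => x y; lia.
      rewrite /H expnMn; case: (N) => [|N']; first by rewrite !muln0.
      have : (0 < h ^ 2)%N by [].
      move: (h ^ 2)%N => h2'; nia.
    apply: (leq_trans (annulus_size _ _ _ _)).
    have -> : (H ^ d' * ((4 * N + 1) ^ d' * (2 * (16 * d * N + 1))) * h =
        (H * (4 * N + 1)) ^ d' * (2 * ((16 * d * N + 1) * h)))%N.
      by rewrite expnMn; ring.
    apply: leq_mul; last by nia.
    have le_base : ((H * (2 * N)).*2.+1 <= H * (4 * N + 1))%N by nia.
    by case: (d') => // m; rewrite leq_exp2r.
  rewrite ler_pdivlMr ?ltr0n // -mulrA -natrM; apply: q_mul_le => //.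
  apply: leq_trans (leq_mul szl (leqnn h)) _.
  have -> : (H ^ d = H ^ d' * (h * h))%N by rewrite expnSr mulnn.
  by apply: eq_leq; ring.
have nil1 : wt H [::] = 1 by rewrite /wt expr0.
apply: (pboundS (@subset_refl _ _) _ (pbound_exists (fun cx _ =>
  pbound_exists (fun cu _ => pbound_exists (fun cv _ => last_ cx cu cv))))).
have b3 : 0 <= (3 + K) * C by rewrite mulr_ge0 // addr_ge0.
have b2 : 0 <= (2 + K) * ((3 + K) * C) by rewrite mulr_ge0 // addr_ge0.
have := sumB [::] _ b2; rewrite nil1 mul1r; apply: le_trans.
apply: ler_sum => cx _; apply: le_trans (sumB [:: cx] _ b3).
by apply: ler_sum => cu _; exact: (sumB [:: cu; cx] _ C0).
Qed.

Lemma tie_free_point (x y u v : point) : x <> y -> u <> v ->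
  ~ ((x = u /\ y = v) \/ (x = v /\ y = u)) ->
  let free a b e f := b <> 0 /\ [/\ b <> a, b <> e & b <> f] in
  [\/ free x y u v, free y x u v, free u v x y | free v u x y].
Proof.
move=> xy uv n free; rewrite /free.
have [y0|/eqP y0] := eqVneq y 0; have [x0|/eqP x0] := eqVneq x 0;
have [v0|/eqP v0] := eqVneq v 0; have [u0|/eqP u0] := eqVneq u 0;
have [xu|/eqP xu] := eqVneq x u; have [xv|/eqP xv] := eqVneq x v;
have [yu|/eqP yu] := eqVneq y u; have [yv|/eqP yv] := eqVneq y v;
try (exfalso; by (apply: xy; congruence) || (apply: uv; congruence) ||
  (apply: n; intuition congruence));
try (by constructor 1; split; [|split]; congruence);
try (by constructor 2; split; [|split]; congruence);
try (by constructor 3; split; [|split]; congruence);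
try (by constructor 4; split; [|split]; congruence).
Qed.

Lemma ties_sub H N (Z : set point) : (0 < H)%N -> Z `<=` [set 0] ->
  [set w | exists x y u v, [/\ (Phi w `|` Z) x /\ edist 0 x <= N%:R,
     (Phi w `|` Z) y /\ edist 0 y <= N%:R, (Phi w `|` Z) u /\ edist 0 u <= N%:R &
     (Phi w `|` Z) v /\ edist 0 v <= N%:R] /\ [/\ x <> y, edist x y = edist u v &
     ~ ((x = u /\ y = v) \/ (x = v /\ y = u))]] `<=` bad_cells H N `|` tied_cells H N.
Proof.
move=> H0 Z0 w [x [y [u [v [[hx hy hu hv] [xy e n]]]]]].
have uv : u <> v by move=> uv; apply: xy; apply: edist_eq0; rewrite e uv edistxx.
have [bad|good] := pselect (bad_cells H N w); [by left|right].
have main (a b f g : point) : (Phi w `|` Z) a /\ edist 0 a <= N%:R ->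
    (Phi w `|` Z) b /\ edist 0 b <= N%:R -> (Phi w `|` Z) f /\ edist 0 f <= N%:R ->
    (Phi w `|` Z) g /\ edist 0 g <= N%:R -> edist a b = edist f g ->
    b <> 0 /\ [/\ b <> a, b <> f & b <> g] -> tied_cells H N w.
  move=> [Sa aN] [Sb bN] [Sf fN] [Sg gN] eab [b0 [ba bf bg]].
  have inN z : edist 0 z <= N%:R -> cidx H z \in nbr 0 (H * N).
    by move=> zN; have := cidx_near H zN; rewrite cidx0.
  have o z : (Phi w `|` Z) z -> occ0 H (cidx H z) w.
    move=> [Pz|/Z0 ->]; last by left; rewrite cidx0.
    by right; exact: occP.
  exists (cidx H a); first exact: inN.
  exists (cidx H f); first exact: inN.
  exists (cidx H g); first exact: inN.
  have ab2 : edist a b <= (2 * N)%N%:R.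
    rewrite (le_trans (edist_triangle 0 _ _)) // (edistC a).
    by rewrite natrM; move: aN bN; lra.
  exists (cidx H b).
    rewrite mem_filter cidx_near // andbT /=.
    have := sqd_near H ab2; have := ab2; rewrite eab => fg2.
    have := sqd_near H fg2; rewrite !ler_norml.
    move: (d * _)%N (sqd _ (cidx H a)) (sqd _ (cidx H f)) => k s1 s2.
    move=> /andP[h1 h2] /andP[h3 h4].
    rewrite -!(ler_int R) intrB intrD intrM (_ : 2%:~R = 2 :> R) //.
    rewrite -[k%:Z%:~R]/(k%:R); by apply/andP; split; lra.
  split.
    rewrite !inE !negb_or; apply/and4P.
    have c := @good_cell_inj H N w Z H0 Z0 good.
    by split; apply/eqP; [exact: (good_cell0 H0 Z0 good Sb)|exact: c|exact: c|exact: c].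
  move=> z; rewrite !inE => /or4P[]/eqP->; exact: o.
have [fr|fr|fr|fr] := tie_free_point xy uv n.
- exact: (main x y u v).
- by apply: (main y x u v) => //; rewrite edistC.
- exact: (main u v x y).
- by apply: (main v u x y) => //; rewrite edistC.
Qed.

Lemma no_ties_ae (Z : set point) : Z `<=` [set 0] ->
  P.-negligible [set w | ~ no_ties (Phi w `|` Z)].
Proof.
move=> Z0; pose tie N := [set w | exists x y u v,
     [/\ (Phi w `|` Z) x /\ edist 0 x <= N%:R,
     (Phi w `|` Z) y /\ edist 0 y <= N%:R, (Phi w `|` Z) u /\ edist 0 u <= N%:R &
     (Phi w `|` Z) v /\ edist 0 v <= N%:R] /\ [/\ x <> y, edist x y = edist u v &
     ~ ((x = u /\ y = v) \/ (x = v /\ y = u))]].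
apply: (@negligibleS _ _ _ P (\bigcup_N tie N)); last first.
  apply: negligible_bigcup => N; apply: pbound_negligible => e e0.
  pose K := lam * ((2 * N + 1) ^ d)%N%:R.
  pose A := (1 + K) * ((2 + K) * ((3 + K) *
    (lam * (((4 * N + 1) ^ d') * (2 * (16 * d * N + 1)))%N%:R))).
  pose B := lam * (1 + K).
  have K0 : 0 <= K by rewrite mulr_ge0 // ltW.
  have B0 : 0 <= B by rewrite mulr_ge0 ?addr_ge0 // ltW.
  have A0 : 0 <= A by rewrite !mulr_ge0 ?addr_ge0 // ltW.
  pose h := (Num.Def.archi_bound ((A + B) / e)).+1.
  have h0 : (0 < h)%N by [].
  have H0 : (0 < h ^ 2)%N by rewrite expn_gt0.
  apply: (pboundS (@ties_sub _ N Z H0 Z0) _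
    (pboundU (bad_cells_bound N H0) (tied_cells_bound N h0))).
  have hR : (0 : R) < h%:R by rewrite ltr0n.
  apply: (@le_trans _ _ ((A + B) / h%:R)).
    rewrite [X in _ <= X]mulrDl [X in _ <= X]addrC lerD //.
      rewrite /B [X in _ <= X]mulrAC ler_wpM2r ?addr_ge0 //.
      rewrite ler_pM2l // lef_pV2 ?posrE ?exprn_gt0 ?ltr0n // -natrX ler_nat -expnM.
      by rewrite -{1}[h]expn1 leq_pexp2l.
    by rewrite /A -!mulrA.
  rewrite ler_pdivrMr // mulrC -ler_pdivrMr //.
  rewrite (le_trans (ltW (archi_boundP _))) ?divr_ge0 ?addr_ge0 // ?ltW //.
  by rewrite ltr_nat.
move=> w /=; apply: contra_notP => nT x y u v Sx Sy Su Sv xy e.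
apply: contrapT => n; apply: nT.
pose r := edist 0 x + edist 0 y + edist 0 u + edist 0 v.
have r0 : 0 <= r by rewrite !addr_ge0 ?edist_ge0.
have [hx hy hu hv] := And4 (edist_ge0 0 x) (edist_ge0 0 y) (edist_ge0 0 u) (edist_ge0 0 v).
have := archi_boundP r0; set N := Num.Def.archi_bound r => rN.
exists N => //; exists x, y, u, v; split=> //; split; split=> //; move: rN; rewrite /r; lra.
Qed.

End Ties.

(** * Long descending chains *)

Section ChainLists.
Variables (R : realType) (d : nat).
Notation point := 'rV[R]_d.
Implicit Types (S : set point) (L N B : R) (st : seq (point * point)).

Lemma flat_cat st st' : flat (st ++ st') = flat st ++ flat st'.
Proof. by elim: st => //= -[v u] st ->; rewrite catA. Qed.

Lemma dchain_relax S L N B u st : dchain S L N B u st -> dchain S L N L u st.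
Proof. by case: st => //= -[v u'] st [h1 h2 [h3 _] h4 h5]. Qed.

Lemma dchain_cat S L N B u st st' : dchain S L N B u (st ++ st') ->
  dchain S L N B u st /\ dchain S L N L (last u (unzip2 st)) st'.
Proof.
elim: st u B => [|[v u'] st IH] u B /=.
  move=> h; split; last exact: dchain_relax h.
  by case: st' h => //= -[v u'] st' [].
by move=> [h1 h2 h3 h4 /IH[h5 h6]].
Qed.

Lemma dchain_mem S L N B u st : dchain S L N B u st ->
  forall y, y \in u :: flat st -> S y /\ edist 0 y <= N.
Proof.
elim: st u B => [|[v u'] st IH] u B /=.
  by move=> h y; rewrite inE => /eqP->.
move=> [h1 h2 _ _ /IH h] y; rewrite !inE mem_cat => /or4P[/eqP->//|/eqP->//|yu|yst].
- by apply: h; move: yu; case: ifP => // _; rewrite !inE => ->.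
- by apply: h; rewrite inE yst orbT.
Qed.

Lemma dchain_sub S S' L N B u st : dchain S L N B u st ->
  (forall y, y \in u :: flat st -> S y -> S' y) -> dchain S' L N B u st.
Proof.
elim: st u B => [|[v u'] st IH] u B /=.
  by move=> [Su uN] h; split=> //; apply: h => //; rewrite mem_head.
move=> [[Su uN] [Sv vN] h3 h4 ch] h.
split=> //; [|split=> //|].
- by split=> //; apply: h => //; rewrite mem_head.
- by apply: h => //; rewrite !inE eqxx orbT.
apply: (IH _ _ ch) => y yu Sy; apply: h => //.
move: yu; rewrite !inE mem_cat => /orP[/eqP->|->]; last by rewrite !orbT.
by case: (eqVneq v u') => _; rewrite ?inE ?eqxx ?orbT.
Qed.

(* A chain visits the origin at most once, so half of a long chain avoids it. *)
Lemma chain_avoiding_origin S L N n :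
  (forall u st, dchain S L N L u st -> uniq (u :: flat st) -> size st = n ->
     0 \in u :: flat st) ->
  forall u st B, dchain S L N B u st -> uniq (u :: flat st) ->
    (size st < n.*2.+1)%N.
Proof.
move=> hz u st B /dchain_relax ch un; rewrite ltnNge; apply/negP => le_n.
pose s1 := take n st; pose s2 := drop n st.
have st12 : st = s1 ++ s2 by rewrite cat_take_drop.
have sz1 : size s1 = n by rewrite size_takel //; lia.
have sz2 : (n < size s2)%N by rewrite size_drop; lia.
case s2E : s2 sz2 => [//|[v u'] s3] /= sz3.
pose s4 := take n s3; pose s5 := drop n s3.
have s45 : s3 = s4 ++ s5 by rewrite cat_take_drop.
have sz4 : size s4 = n by rewrite size_takel.
rewrite st12 s2E s45 in ch un.
have [ch1 [_ _ _ _ /dchain_cat[ch4 _]]] := dchain_cat ch.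
have fE : flat ((v, u') :: s4 ++ s5) =
    v :: (if v == u' then [::] else [:: u']) ++ flat s4 ++ flat s5.
  by rewrite /= flat_cat.
move: un; rewrite flat_cat -cat_cons cat_uniq fE => /and3P[un1 dis un2].
have z1 := hz _ _ ch1 un1 sz1.
have sub4 : {subset u' :: flat s4 <= v :: (if v == u' then [::] else [:: u']) ++
    flat s4 ++ flat s5}.
  move=> y; rewrite !inE !mem_cat => /orP[/eqP->|->]; last by rewrite !orbT.
  by case: (eqVneq v u') => _; rewrite ?inE ?eqxx ?orbT.
have un4 : uniq (u' :: flat s4).
  have : subseq (u' :: flat s4) (v :: (if v == u' then [::] else [:: u']) ++
    flat s4 ++ flat s5).
    case: (eqVneq v u') => [->|vu'] /=; first by rewrite eqxx prefix_subseq.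
    by rewrite eq_sym (negPf vu') eqxx prefix_subseq.
  by move=> /subseq_uniq; apply.
have z4 := hz _ _ (dchain_relax ch4) un4 sz4.
by move/negP: dis; apply; apply/hasP; exists 0 => //; exact: sub4.
Qed.

End ChainLists.

Section ChainCount.
Variables (R : realType) (d' : nat) (d0 : measure_display) (T : measurableType d0).
Notation d := d'.+1.
Variables (P : probability T R) (lam : R) (Phi : T -> set 'rV[R]_d).
Hypothesis lam0 : 0 < lam.
Hypothesis hP : is_hPPP P lam Phi.
Notation point := 'rV[R]_d.
Notation idx := {ffun 'I_d -> int}.
Local Notation q H := (lam / H%:R ^+ d).
Local Notation occ := (occ Phi).

Variables (M N G h : nat).
Hypotheses (G0 : (0 < G)%N) (h0 : (0 < h)%N) (hbig : (2 * d * G * M <= h)%N).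
Let H := (G * h)%N.
Let H0 : (0 < H)%N. Proof. by rewrite muln_gt0 G0. Qed.
Let q0 : 0 <= q H := q_ge0 d lam0 H.

(* Cells reached from [c] by steps whose length [r] satisfies
   [b <= (G r)^2 < b + 1]. *)
Definition band (b : nat) (c : idx) : seq idx :=
  [seq c1 <- nbr c (H * M) | let e := (d * (2 * (H * M)))%N%:Z in
     (b * h ^ 2)%N%:Z - e <= sqd c1 c <= (b.+1 * h ^ 2)%N%:Z + e].

Lemma band_size b c :
  q H * (size (band b c))%:R <= lam * (6 * (2 * M + 1) ^ d')%N%:R / G%:R.
Proof.
rewrite ler_pdivlMr ?ltr0n // -(mulrA (q H)) -natrM; apply: q_mul_le => //.
pose a := (b * h ^ 2)%N%:Z - (d * (2 * (H * M)))%N%:Z.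
have : (size (band b c) <= size [seq c1 <- nbr c (H * M) |
    (a <= sqd c1 c <= a + ((2 * h) ^ 2)%N%:Z)%R])%N.
  rewrite !size_filter; apply: sub_count => c1 /= /andP[h1 h2].
  rewrite h1 /= (le_trans h2) // /a.
  suff : (h ^ 2 + 2 * (d * (2 * (H * M))) <= (2 * h) ^ 2)%N.
    by rewrite mulSn; move: (d * (2 * (H * M)))%N (b * h ^ 2)%N (h ^ 2)%N ((2 * h) ^ 2)%N => *; lia.
  rewrite /H -!mulnn.
  have : (2 * d * G * M * h <= h * h)%N by rewrite leq_mul2r hbig orbT.
  by move: d => k; nia.
move=> /leq_trans/(_ (annulus_size _ _ _ _)) le_s.
apply: leq_trans (leq_mul le_s (leqnn G)) _.
have -> : (H ^ d * (6 * (2 * M + 1) ^ d') =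
    (H * (2 * M + 1)) ^ d' * (6 * h) * G)%N.
  by rewrite expnSr expnMn {2}/H; ring.
rewrite leq_mul2r; apply/orP; right; apply: leq_mul; last by lia.
have le_base : ((H * M).*2.+1 <= H * (2 * M + 1))%N by nia.
by case: (d') => // m; rewrite leq_exp2r.
Qed.

Definition chains n (b : nat) (c : idx) (acc : seq idx) : set T :=
  [set w | exists u st B, [/\ cidx H u = c, dchain (Phi w) M%:R N%:R B u st,
     size st = n, (G%:R * B) ^+ 2 < b.+1%:R &
     uniq (acc ++ map (cidx H) (flat st)) /\
     inter (acc ++ map (cidx H) (flat st)) (occ H) w]].

Lemma chains_step n b c acc : chains n.+1 b c acc `<=`
  [set w | exists2 b', b' \in iota 0 b.+1 & exists2 c1, c1 \in band b' c &
     (chains n b' c1 (acc ++ [:: c1]) `|` [set w | exists2 c2, c2 \in nbr c1 (H * M) &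
        chains n b' c2 (acc ++ [:: c1; c2]) w]) w].
Proof.
move=> w [u [[|[v u'] st] [B [//= cu [[Pu uN] [Pv vN] [uvM uvB] vuM ch] [sz] GB]]]] hun.
set x := (G%:R * edist u v) ^+ 2.
have e0 := edist_ge0 u v.
have x0 : 0 <= x by rewrite sqr_ge0.
have xB : x < b.+1%:R.
  apply: le_lt_trans GB; rewrite ler_pXn2r ?nnegrE ?mulr_ge0 //.
    by rewrite ler_wpM2l.
  exact: le_trans uvB.
have [b' /andP[bx xb]] : exists b' : nat, b'%:R <= x < b'.+1%:R.
  by exists (Num.Def.truncn x); exact: truncn_itv.
exists b'; first by rewrite -/(iota 0 b.+1) mem_iota /= add0n -(ltr_nat R) (le_lt_trans bx).
exists (cidx H v).
  rewrite mem_filter -cu cidx_near // andbT /=.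
  have := sqd_near H uvM; rewrite ler_norml.
  have -> : (H%:R * edist u v) ^+ 2 = h%:R ^+ 2 * x.
    by rewrite /x /H natrM; ring.
  have hh : (0 : R) < h%:R ^+ 2 by rewrite exprn_gt0 // ltr0n.
  have l1 : (b' * h ^ 2)%N%:R <= h%:R ^+ 2 * x.
    by rewrite natrM natrX mulrC ler_pM2l.
  have l2 : h%:R ^+ 2 * x <= (b'.+1 * h ^ 2)%N%:R.
    by rewrite natrM natrX mulrC ler_pM2r // ltW.
  move: l1 l2; move: (d * _)%N (b' * _)%N (b'.+1 * _)%N (sqd _ _) => k k1 k2 s l1 l2.
  move=> /andP[h1 h2].
  rewrite -!(ler_int R) intrB intrD.
  rewrite -[k%:Z%:~R]/(k%:R) -[k1%:Z%:~R]/(k1%:R) -[k2%:Z%:~R]/(k2%:R).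
  by apply/andP; split; lra.
move: hun => /=; have [vu'|_] := eqVneq v u'.
  rewrite /= -cat1s catA => hun; left.
  by exists u', st, (edist u v); split=> //; rewrite vu'.
rewrite /= -[_ :: _ :: _]/([:: cidx H v; cidx H u'] ++ _) catA => hun; right.
exists (cidx H u'); first by apply: cidx_near.
by exists u', st, (edist u v); split.
Qed.

Variables eps Lam : R.
Hypotheses (eps0 : 0 <= eps) (Lam0 : 0 <= Lam).
Hypothesis band_eps : forall b c, q H * (size (band b c))%:R <= eps.
Hypothesis nbr_Lam : forall c : idx, q H * (size (nbr c (H * M)))%:R <= Lam.

Lemma chains_bound n b c acc : pbound P (chains n b c acc)
  (2 ^+ b * (2 * (eps * (1 + Lam))) ^+ n * q H ^+ size acc).
Proof.
set Q := q H; set e := 2 * _; have e0 : 0 <= e by rewrite !mulr_ge0 // addr_ge0.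
elim: n b c acc => [|n IH] b c acc.
  have [uacc|nuacc] := boolP (uniq acc); last first.
    apply: pbound_set0.
      move=> w [u [st [B [_ _ /size0nil-> _ []]]]]; rewrite /= cats0.
      by rewrite (negPf nuacc).
    by rewrite !mulr_ge0 ?exprn_ge0.
  apply: (pboundS _ _ (pbound_occ hP lam0 H0 uacc)).
    by move=> w [u [st [B [_ _ /size0nil-> _ []]]]]; rewrite /= cats0.
  rewrite expr0 mulr1 ler_peMl ?exprn_ge0 // exprn_ege1 //.
  by rewrite ler1n.
pose X b' := 2 ^+ b' * e ^+ n * Q ^+ size acc.
have X0 b' : 0 <= X b' by rewrite !mulr_ge0 ?exprn_ge0.
have inner b' c1 : pbound P (chains n b' c1 (acc ++ [:: c1]) `|`
    [set w | exists2 c2, c2 \in nbr c1 (H * M) &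
        chains n b' c2 (acc ++ [:: c1; c2]) w]) (Q * (1 + Lam) * X b').
  apply: (pboundS (@subset_refl _ _) _ (pboundU (IH b' c1 _)
    (pbound_exists (fun c2 _ => IH b' c2 _)))).
  rewrite (eq_bigr (fun=> Q * (Q * X b'))); last first.
    by move=> c2 _; rewrite size_cat /= addn2 !exprS /X; ring.
  rewrite big_const_seq count_predT iter_addr_0 -[X in _ + X]mulr_natr.
  rewrite size_cat /= addn1 exprS.
  have -> : 2 ^+ b' * e ^+ n * (Q * Q ^+ size acc) = Q * X b'.
    by rewrite /X; ring.
  have := nbr_Lam c1; rewrite -/Q; set sz := (size _)%:R => hsz.
  have -> : Q * X b' + Q * (Q * X b') * sz =
    (Q * X b') * (1 + Q * sz) by ring.
  have -> : Q * (1 + Lam) * X b' = Q * X b' * (1 + Lam) by ring.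
  by apply: ler_wpM2l; [exact: mulr_ge0|rewrite lerD2l].
have mid b' : pbound P [set w | exists2 c1, c1 \in band b' c &
     (chains n b' c1 (acc ++ [:: c1]) `|` [set w | exists2 c2, c2 \in nbr c1 (H * M) &
        chains n b' c2 (acc ++ [:: c1; c2]) w]) w] (e / 2 * X b').
  apply: (pboundS (@subset_refl _ _) _ (pbound_exists (fun c1 _ => inner b' c1))).
  rewrite big_const_seq count_predT iter_addr_0 -[X in X <= _]mulr_natr.
  have := band_eps b' c; rewrite -/Q; set sz := (size _)%:R => hsz.
  have -> : Q * (1 + Lam) * X b' * sz = (1 + Lam) * X b' * (Q * sz) by ring.
  have -> : e / 2 * X b' = (1 + Lam) * X b' * eps by rewrite /e; field.
  by rewrite ler_wpM2l // mulr_ge0 // addr_ge0.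
apply: (pboundS (@chains_step n b c acc) _ (pbound_exists (fun b' _ => mid b'))).
rewrite -mulr_sumr.
have -> : e / 2 * (\sum_(i <- iota 0 b.+1) X i) =
   (e ^+ n.+1 * Q ^+ size acc / 2) * (\sum_(i <- iota 0 b.+1) 2 ^+ i).
  by rewrite /X -!mulr_suml exprS; field.
have geo : \sum_(i <- iota 0 b.+1) 2 ^+ i <= 2 ^+ b.+1 :> R.
  elim: (b.+1) => [|k IHk]; first by rewrite big_nil.
  rewrite -addn1 iotaD add0n big_cat /= big_seq1 addn1 [X in _ <= X]exprS.
  by move: IHk; lra.
apply: le_trans (ler_wpM2l _ geo) _; first by rewrite !mulr_ge0 ?exprn_ge0.
by rewrite [2 ^+ b.+1]exprS le_eqVlt; apply/orP; left; apply/eqP; field.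
Qed.

End ChainCount.

Section LongChains.
Variables (R : realType) (d' : nat) (d0 : measure_display) (T : measurableType d0).
Notation d := d'.+1.
Variables (P : probability T R) (lam : R) (Phi : T -> set 'rV[R]_d).
Hypothesis lam0 : 0 < lam.
Hypothesis hP : is_hPPP P lam Phi.
Notation point := 'rV[R]_d.
Notation idx := {ffun 'I_d -> int}.
Local Notation q H := (lam / H%:R ^+ d).

Definition long_chain (M N n : nat) : set T := [set w | exists u st,
  [/\ dchain (Phi w) M%:R N%:R M%:R u st, uniq (u :: flat st) & size st = n]].

Lemma long_chain_sub M N G h : (0 < G)%N -> (0 < h)%N ->
  long_chain M N ((G * M) ^ 2) `<=` bad_cells Phi (G * h) N `|`
    [set w | exists2 c, c \in nbr 0 (G * h * N) &
      chains Phi M N G h ((G * M) ^ 2) ((G * M) ^ 2) c [:: c] w].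
Proof.
move=> G0 h0 w [u [st [ch un sz]]]; set H := (G * h)%N.
have H0 : (0 < H)%N by rewrite muln_gt0 G0.
have [bad|good] := pselect (bad_cells Phi H N w); [by left|right].
have mem := dchain_mem ch.
have [Pu uN] := mem u (mem_head _ _).
exists (cidx H u); first by have := cidx_near H uN; rewrite cidx0.
exists u, st, M%:R; split=> //.
  by rewrite -natrM -natrX ltr_nat.
rewrite cat1s -map_cons; split.
  rewrite map_inj_in_uniq // => x y xs ys; apply: contra_eq => /eqP xy.
  have [Px xN] := mem x xs; have [Py yN] := mem y ys; apply/eqP.
  have set0S : set0 `<=` [set (0 : point)] by [].
  exact: (good_cell_inj H0 set0S good (or_introl Px) (or_introl Py) xN).
by move=> c /mapP[x xs ->]; have [Px _] := mem x xs; exact: occP.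
Qed.

Lemma long_chain_bound M N G (e : R) : (0 < G)%N ->
  8 * ((lam * (6 * (2 * M + 1) ^ d')%N%:R / G%:R) *
       (1 + lam * ((2 * M + 1) ^ d)%N%:R)) <= 1 -> 0 < e ->
  pbound P (long_chain M N ((G * M) ^ 2))
    (e + lam * ((2 * N + 1) ^ d)%N%:R * 2^-1 ^+ ((G * M) ^ 2)).
Proof.
move=> G0 small e0; set n := ((G * M) ^ 2)%N.
set K := lam * ((2 * N + 1) ^ d)%N%:R.
have K0 : 0 <= K by rewrite mulr_ge0 // ltW.
set eps := lam * _ / _ in small; set Lam := lam * _ in small.
have eps0 : 0 <= eps by rewrite !mulr_ge0 ?invr_ge0 // ltW.
have Lam0 : 0 <= Lam by rewrite mulr_ge0 // ltW.
pose a := Num.Def.archi_bound (lam * (1 + K) / e).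
pose h := (2 * d * G * M + a).+1.
have h0 : (0 < h)%N by [].
have hbig : (2 * d * G * M <= h)%N by rewrite /h; lia.
set H := (G * h)%N; have H0 : (0 < H)%N by rewrite muln_gt0 G0.
apply: (pboundS (@long_chain_sub M N G h G0 h0) _ (pboundU (bad_cells_bound lam0 hP N H0)
  (pbound_exists (fun c _ => chains_bound lam0 hP N G0 h0 eps0 Lam0
     (fun b c => band_size lam0 G0 h0 hbig b c) (fun c => q_nbr_le lam0 M c H0) n n c _)))).
apply: lerD.
  apply: (@le_trans _ _ (lam * (1 + K) / h%:R)).
    rewrite [X in _ <= X]mulrAC; apply: ler_wpM2r; first by rewrite addr_ge0.
    rewrite ler_pM2l // lef_pV2 ?posrE ?exprn_gt0 ?ltr0n // -natrX ler_nat.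
    rewrite (@leq_trans H) //; first by rewrite leq_pmull.
    by rewrite -{1}[H]expn1 leq_pexp2l.
  rewrite ler_pdivrMr ?ltr0n // [X in _ <= X]mulrC -ler_pdivrMr //.
  have lam1 := ltW lam0; have e1 := ltW e0.
  apply: le_trans (ltW (archi_boundP _)) _.
    by rewrite divr_ge0 // mulr_ge0 // addr_ge0.
  by rewrite ler_nat /h -/a; lia.
rewrite (eq_bigr (fun=> 2 ^+ n * (2 * (eps * (1 + Lam))) ^+ n * q H)); last first.
  by move=> c _; rewrite expr1.
rewrite big_const_seq count_predT iter_addr_0 -[X in X <= _]mulr_natr -mulrA.
rewrite [X in X <= _]mulrC; apply: ler_pM.
- by rewrite mulr_ge0 ?q_ge0.
- apply: mulr_ge0; apply: exprn_ge0 => //.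
  by apply: mulr_ge0 => //; apply: mulr_ge0 => //; exact: addr_ge0.
- exact: q_nbr_le.
have x0 : 0 <= eps * (1 + Lam) by apply: mulr_ge0 => //; exact: addr_ge0.
rewrite -exprMn; apply: lerXn2r; rewrite ?nnegrE ?invr_ge0 //.
  by apply: mulr_ge0 => //; apply: mulr_ge0.
by move: small; set x := eps * _; lra.
Qed.

End LongChains.

(** * Hierarchical clusters *)

Section Patterns.
Variables (R : realType) (d' : nat).
Notation d := d'.+1.
Notation point := 'rV[R]_d.
Notation idx := {ffun 'I_d -> int}.

Definition shift (z : idx) (t : int) : idx :=
  [ffun i => z i + (if i == ord0 then t else 0)].

(* Offsets, widths and isolation radii of the hierarchical clusters of [2^k]
   cells on a line: two copies of level [k], far apart compared with their
   diameter. *)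
Definition iso (w : nat) : nat := (d * w.+1).+1.
Fixpoint width (k : nat) : nat :=
  if k is k'.+1 then width k' + (width k' + iso (width k')).+1 else 0.
Definition gap k := (width k + iso (width k)).+1.
Fixpoint offs (k : nat) : seq nat :=
  if k is k'.+1 then offs k' ++ [seq t + gap k' | t <- offs k'] else [:: 0%N].

Lemma offs_le k t : t \in offs k -> (t <= width k)%N.
Proof.
elim: k t => [|k IH] t /=; first by rewrite inE => /eqP->.
rewrite mem_cat => /orP[/IH|/mapP[t' /IH le_t ->]]; rewrite /gap; lia.
Qed.

Lemma offs_gap k t : t \in offs k -> (t + gap k)%N \in offs k.+1.
Proof.
by move=> tk; rewrite /= mem_cat; apply/orP; right; apply/mapP; exists t.
Qed.

Lemma shift0 z : shift z 0 = z.
Proof. by apply/ffunP => i; rewrite ffunE; case: ifP; rewrite addr0. Qed.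

Lemma shiftD z a b : shift (shift z a) b = shift z (a + b).
Proof. by apply/ffunP => i; rewrite !ffunE; case: ifP; rewrite ?addr0 ?addrA. Qed.

Lemma cidx1_coord (x y : point) i :
  `|(x ord0 i - y ord0 i) - (cidx 1 x i - cidx 1 y i)%:~R| <= 1.
Proof.
have [_ h _] := cidx_coord 1 i (lexx (edist x y)).
by rewrite distrC; move: h; rewrite !mul1r.
Qed.

Lemma cells_dist_le (x y : point) (m : nat) :
  (forall i, `|cidx 1 x i - cidx 1 y i| <= m%:Z) -> edist x y < (iso m)%:R.
Proof.
move=> h; apply: (@le_lt_trans _ _ (d%:R * m.+1%:R)); last first.
  by rewrite -natrM ltr_nat.
apply: edist_le_coord => // i; have := cidx1_coord x y i.
have : `|(cidx 1 x i - cidx 1 y i)%:~R| <= m%:R :> R.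
  by rewrite -intr_norm -[m%:R]/(m%:Z%:~R) ler_int.
by rewrite -natr1 !ler_norml => /andP[? ?] /andP[? ?]; apply/andP; split; lra.
Qed.

Lemma cells_dist_ge (x y : point) (m : nat) i :
  m.+1%:Z <= `|cidx 1 x i - cidx 1 y i| -> m%:R <= edist x y.
Proof.
move=> h; apply: le_trans (edist_coord x y i); have := cidx1_coord x y i.
have : m.+1%:R <= `|(cidx 1 x i - cidx 1 y i)%:~R| :> R.
  by rewrite -intr_norm -[m.+1%:R]/(m.+1%:Z%:~R) ler_int.
set a := _%:~R; set b := x ord0 i - y ord0 i; rewrite -natr1 => h1 h2.
have := ler_normD b (a - b); rewrite (_ : b + (a - b) = a); last by ring.
by rewrite (distrC a b); move: h1 h2; lra.
Qed.

Definition cluster (S : set point) k z : set point :=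
  [set x | S x /\ exists2 t, t \in offs k & cidx 1 x = shift z t%:Z].

Lemma cluster_cell S k z x i : cluster S k z x -> `|cidx 1 x i - z i| <= (width k)%:Z.
Proof.
move=> [_ [t /offs_le le_t ->]]; rewrite ffunE addrC addKr.
by case: ifP => _; rewrite ?normr0 // ler_norml; lia.
Qed.

Lemma cluster_diam S k z x y : cluster S k z x -> cluster S k z y ->
  edist x y < (iso (width k))%:R.
Proof.
move=> [_ [t /offs_le le_t cx]] [_ [t' /offs_le le_t' cy]].
apply: cells_dist_le => i; rewrite cx cy !ffunE.
by case: ifP => _; rewrite ler_norml; lia.
Qed.

Lemma cluster_block S k z :
  (forall t, t \in offs k -> exists x, S `&` [set y | cidx 1 y = shift z t%:Z] = [set x]) ->
  (forall a y, cluster S k z a -> S y -> ~ cluster S k z y ->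
     (iso (width k))%:R <= edist a y) ->
  block S k (cluster S k z).
Proof.
elim: k z => [|k IH] z one far.
  have [|x hx] := one 0%N; first by rewrite inE.
  rewrite shift0 in hx.
  have [Sx _] : (S `&` [set y | cidx 1 y = z]) x by rewrite hx.
  exists x => //; rewrite -hx; apply/seteqP; split=> y [Sy].
    by move=> [t]; rewrite inE => /eqP->; rewrite shift0.
  by move=> /= cy; split=> //; exists 0%N; rewrite ?inE ?shift0.
set A1 := cluster S k z; set A2 := cluster S k (shift z (gap k)%:Z).
have A12 : cluster S k.+1 z = A1 `|` A2.
  apply/seteqP; split=> y.
    move=> [Sy [t]]; rewrite /= mem_cat => /orP[tk cy|/mapP[t' tk ->] cy].
      by left; split=> //; exists t.
    by right; split=> //; exists t' => //; rewrite shiftD -PoszD addnC.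
  case=> -[Sy [t tk cy]]; split=> //.
    by exists t => //=; rewrite mem_cat tk.
  exists (t + gap k)%N; first exact: offs_gap.
  by rewrite addnC PoszD -shiftD.
have sep a b : A1 a -> A2 b -> (iso (width k))%:R <= edist a b.
  move=> [_ [t /offs_le le_t ca]] [_ [t' /offs_le le_t' cb]].
  apply: (@cells_dist_ge _ _ _ ord0); rewrite ca cb !ffunE eqxx /gap.
  by rewrite ler0_norm; lia.
have iso_le : (iso (width k) <= iso (width k.+1))%N.
  by rewrite /iso ltnS leq_mul2l ltnS /= leq_addr ?orbT.
exists A1, A2; split=> //.
- apply: IH => [t tk|a y A1a Sy nA1y]; first by apply: one; rewrite /= mem_cat tk.
  have [A2y|nA2y] := pselect (A2 y); first exact: sep.
  apply: (@le_trans _ _ (iso (width k.+1))%:R); first by rewrite ler_nat.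
  by apply: far => //; rewrite A12; [left|case].
- apply: IH => [t tk|a y A2a Sy nA2y].
    rewrite shiftD -PoszD addnC; apply: one.
    exact: offs_gap.
  have [A1y|nA1y] := pselect (A1 y); first by rewrite edistC; exact: sep.
  apply: (@le_trans _ _ (iso (width k.+1))%:R); first by rewrite ler_nat.
  by apply: far => //; rewrite A12; [right|case].
- rewrite -subset0 => x [A1x A2x]; have := sep _ _ A1x A2x.
  by rewrite edistxx lern0.
- exists (iso (width k.+1))%:R; split=> // a b; exact: cluster_diam.
Qed.

Definition patt k (v : idx) : nat := v \in [seq shift 0 t%:Z | t <- offs k].

Lemma pattP k (c z : idx) :
  reflect (exists2 t, t \in offs k & c = shift z t%:Z) (patt k (c - z) == 1%N).
Proof.
rewrite /patt eqb1; apply: (iffP mapP) => -[t tk h]; exists t => //.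
  apply/ffunP => i; move/ffunP: h => /(_ i); rewrite !ffunE => h.
  by rewrite -[c i](subrK (z i)) h add0r addrC.
by apply/ffunP => i; rewrite h !ffunE; ring.
Qed.

Lemma patt_gap k v : patt k v = 1%N -> v \in nbr 0 (gap k).
Proof.
rewrite /patt => /eqP; rewrite eqb1 => /mapP[t /offs_le le_t ->].
rewrite mem_nbr; apply/forallP => i; rewrite !ffunE.
by case: ifP => _; rewrite ler_norml /gap; lia.
Qed.

Section Occurrence.
Variables (d0 : measure_display) (T : measurableType d0) (Phi : T -> set point).

Definition pattern k z : set T :=
  [set w | forall c, c \in nbr z (gap k) ->
     count_eq Phi (@cell R d 1 c) (patt k (c - z)) w].

Lemma pattern_block k z (w : T) (Z : set point) : Z `<=` [set 0] ->
  0 \notin nbr z (gap k) -> pattern k z w ->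
  block (Phi w `|` Z) k (cluster (Phi w `|` Z) k z).
Proof.
move=> Z0 z0 pat; set S := Phi w `|` Z.
have inPhi x : S x -> cidx 1 x \in nbr z (gap k) -> Phi w x.
  by move=> [//|/Z0 ->]; rewrite cidx0 (negPf z0).
apply: cluster_block => [t tk|a y ca Sy ncy].
  have cin : shift z t%:Z \in nbr z (gap k).
    rewrite mem_nbr; apply/forallP => i; have := offs_le tk; rewrite !ffunE.
    by case: ifP => _; rewrite ler_norml /gap; lia.
  have /eqP p1 : patt k (shift z t%:Z - z) == 1%N by apply/pattP; exists t.
  have := pat _ cin; rewrite p1 => /count1P[x hx]; exists x; rewrite -hx.
  apply/seteqP; split=> y.
    move=> [Sy /= cy]; split; first by apply: inPhi => //; rewrite cy.
    exact/cellP.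
  by move=> [Py /cellP]; move=> /(_ isT) cy; split=> //; left.
have [yin|yout] := boolP (cidx 1 y \in nbr z (gap k)).
  have Py := inPhi _ Sy yin; have := pat _ yin.
  have [/pattP[t tk cy]|] := boolP (patt k (cidx 1 y - z) == 1%N).
    by case: ncy; split=> //; exists t.
  rewrite /patt; case: (_ \in _) => // _ /count0P/(_ y Py) h.
  by case: h; apply/cellP.
move: yout; rewrite mem_nbr negb_forall => /existsP[i].
rewrite -ltNge => yi; have ai := cluster_cell i ca.
apply: (@cells_dist_ge _ _ _ i); rewrite distrC.
have := ler_normB (cidx 1 y i - cidx 1 a i) (z i - cidx 1 a i).
rewrite [_ - _ - (_ - _)](_ : _ = cidx 1 y i - z i); last by ring.
rewrite (distrC (z i)); move: yi ai; rewrite /gap.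
move: (`|_ - z i|) (`|_ - z i|) (`|cidx 1 y i - cidx 1 a i|) => n1 n2 n3; lia.
Qed.

End Occurrence.
End Patterns.

Section ManyBlocks.
Variables (R : realType) (d' : nat) (d0 : measure_display) (T : measurableType d0).
Notation d := d'.+1.
Variable Phi : T -> set 'rV[R]_d.
Notation point := 'rV[R]_d.
Notation idx := {ffun 'I_d -> int}.
Variable k : nat.
Local Notation rho := (gap d' k).
Local Notation pat := (pattern Phi k).

Definition side := (2 * rho).+1.

(* The candidate windows go away from the hyperplane [x_0 = 0], hence avoid the
   origin. *)
Definition base (z : idx) (j : nat) : idx :=
  shift z ((if 0 <= z ord0 then 1 else -1) * (j * side)%N%:Z).

Lemma base_disjoint z i j c :
  c \in nbr (base z i) rho -> c \in nbr (base z j) rho -> i = j.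
Proof.
rewrite !mem_nbr => /forallP/(_ ord0) + /forallP/(_ ord0).
rewrite !ffunE eqxx !ler_norml /side => hi hj.
have [ij|ij|//] := ltngtP i j.
- have : (i * (2 * rho).+1 + (2 * rho).+1 <= j * (2 * rho).+1)%N.
    by rewrite -mulSnr leq_mul2r ij orbT.
  by move: hi hj; case: ifP => _; rewrite ?mul1r ?mulN1r; move: (i * _)%N (j * _)%N => *; lia.
- have : (j * (2 * rho).+1 + (2 * rho).+1 <= i * (2 * rho).+1)%N.
    by rewrite -mulSnr leq_mul2r ij orbT.
  by move: hi hj; case: ifP => _; rewrite ?mul1r ?mulN1r; move: (i * _)%N (j * _)%N => *; lia.
Qed.

Lemma base_origin z j : (0 < j)%N -> 0 \notin nbr (base z j) rho.
Proof.
move=> j0; apply/negP; rewrite mem_nbr => /forallP/(_ ord0).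
rewrite !ffunE eqxx ler_norml /side.
have : ((2 * rho).+1 <= j * (2 * rho).+1)%N by rewrite leq_pmull.
by case: ifP => h; rewrite ?mul1r ?mulN1r; move: h; move: (j * _)%N => *; lia.
Qed.

Definition bad_blocks (m N : nat) : set T := [set w | exists2 z, z \in nbr (0 : idx) N &
  (inter (iota 1 m) (fun j => ~` pat (base z j)) `|`
   inter (iota m.+1 m) (fun j => ~` pat (base z j))) w].

Definition spread := (d * (width d' k + 2 * side + 1)).+1.

Lemma good_blocks m N (w : T) (Z : set point) : (0 < m)%N -> Z `<=` [set 0] ->
  ~ bad_blocks m N w -> forall c, edist 0 c <= N%:R -> exists A1 A2,
  [/\ block (Phi w `|` Z) k A1, block (Phi w `|` Z) k A2, A1 `&` A2 = set0 &
      A1 `|` A2 `<=` [set y | edist c y < (spread * m)%N%:R]].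
Proof.
move=> m0 Z0 good c cN; set z := cidx 1 c.
have zN : z \in nbr (0 : idx) N by have := cidx_near 1 cN; rewrite cidx0 mul1n.
have pick s : s = iota 1 m \/ s = iota m.+1 m -> exists2 j, j \in s & pat (base z j) w.
  move=> hs; apply: contrapT => nj; apply: good; exists z => //.
  have h : inter s (fun j => ~` pat (base z j)) w.
    by move=> j js pj; apply: nj; exists j.
  by case: hs => e; rewrite -e; [left|right].
have [j1] := pick _ (or_introl erefl); rewrite mem_iota => hj1 pj1.
have [j2] := pick _ (or_intror erefl); rewrite mem_iota => hj2 pj2.
have near j y : (0 < j <= 2 * m)%N -> cluster (Phi w `|` Z) k (base z j) y ->
    edist c y < (spread * m)%N%:R.
  move=> hj cy; have le_j : (j * side <= 2 * m * side)%N.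
    by rewrite leq_mul2r; case/andP: hj => _ ->; rewrite orbT.
  apply: lt_le_trans (cells_dist_le (m := width d' k + 2 * m * side) _) _.
    move=> i; have := cluster_cell i cy; rewrite -/z [base z j i]ffunE.
    move: (cidx 1 y i) (z i) (z ord0) => yi zi z1; rewrite !ler_norml.
    case: (i == ord0); last by move=> /andP[? ?]; apply/andP; split; lia.
    by case: (0 <= z1); move: le_j; rewrite ?mul1r ?mulN1r;
      move: (j * side)%N (2 * m * side)%N => a b; lia.
  rewrite ler_nat /iso /spread; move: side (width d' k) => x y'; move: d => D.
  by move: m0; clear; nia.
exists (cluster (Phi w `|` Z) k (base z j1)), (cluster (Phi w `|` Z) k (base z j2)).
split.
- by apply: pattern_block => //; apply: base_origin; case/andP: hj1.
- by apply: pattern_block => //; apply: base_origin; lia.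
- rewrite -subset0 => y [y1 y2].
  have inQ j : cluster (Phi w `|` Z) k (base z j) y -> cidx 1 y \in nbr (base z j) rho.
    move=> cy; rewrite mem_nbr; apply/forallP => i; have := cluster_cell i cy.
    by move=> /le_trans; apply; rewrite lez_nat /gap; lia.
  have := base_disjoint (inQ _ y1) (inQ _ y2); lia.
- by move=> y [/near|/near]; apply; lia.
Qed.

Variables (P : probability T R) (lam : R).
Hypothesis lam0 : 0 < lam.
Hypothesis hP : is_hPPP P lam Phi.

Definition pattern_prob : R :=
  \prod_(v <- nbr (0 : idx) rho) poisson_pmf lam (patt k v).

Lemma pattern_prob_gt0 : 0 < pattern_prob.
Proof.
by apply: prodr_gt0 => v _; rewrite !mulr_gt0 ?expR_gt0 ?exprn_gt0 ?invr_gt0 ?ltr0n ?fact_gt0.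
Qed.

Lemma pattern_measurable z : measurable (pat z).
Proof.
apply: (@inter_measurable _ _ _ (nbr z rho)
  (fun c => count_eq Phi (@cell R d 1 c) (patt k (c - z)))) => c.
exact: (count_measurable hP).
Qed.

Lemma pattern_joint z (s : seq nat) : uniq s ->
  P (inter s (fun j => pat (base z j))) = (\prod_(j <- s) pattern_prob)%:E.
Proof.
move=> us; pose Q j := nbr (base z j) rho.
pose kk (c : idx) : nat := has (fun j => patt k (c - base z j) == 1%N) s.
have kkE j c : j \in s -> c \in Q j -> kk c = patt k (c - base z j).
  move=> js cj; rewrite /kk; have [p1|p1] := boolP (patt k (c - base z j) == 1%N).
    by rewrite (eqP p1) (_ : has _ _) //; apply/hasP; exists j.
  have -> : patt k (c - base z j) = 0%N by move: p1; rewrite /patt; case: (_ \in _).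
  rewrite (_ : has _ _ = false) //; apply/negP => /hasP[i is_ /eqP pi].
  have ci : c \in Q i.
    rewrite /Q nbr_shift; apply/mapP; exists (c - base z i); first exact: patt_gap.
    by rewrite addrC subrK.
  by move: p1; rewrite (base_disjoint cj ci) pi.
have -> : inter s (fun j => pat (base z j)) =
    inter (flatten [seq Q j | j <- s]) (fun c => count_eq Phi (@cell R d 1 c) (kk c)).
  apply/seteqP; split=> w h.
    by move=> c /flatten_mapP[j js cj]; rewrite (kkE j) //; exact: h.
  move=> j js c cj; rewrite -(kkE j) //; apply: h.
  by apply/flatten_mapP; exists j.
have uf : uniq (flatten [seq Q j | j <- s]).
  elim: (s) us => //= j s' IH /andP[js' us']; rewrite cat_uniq nbr_uniq IH // andbT /=.
  apply/hasPn => c /flatten_mapP[i is' ci]; apply/negP => cj.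
  by move: js'; rewrite (base_disjoint cj ci) is'.
rewrite (cell_counts hP) //; congr (_%:E).
rewrite big_flatten big_map /= -(big_map id xpredT (fun=> pattern_prob)) map_id.
apply: eq_big_seq => j js; rewrite /Q nbr_shift big_map expr1n divr1.
apply: eq_big_seq => v vQ; rewrite (kkE j) //.
  by rewrite addrC addKr.
by rewrite /Q nbr_shift map_f.
Qed.

Lemma pattern_prob_le1 : pattern_prob <= 1.
Proof.
have := pattern_joint 0 (s := [:: 0%N]) isT; rewrite big_seq1 => h.
by rewrite -lee_fin -h probability_le1 //; apply: inter_measurable => j;
  exact: pattern_measurable.
Qed.

Lemma no_pattern_bound z (s : seq nat) : uniq s ->
  pbound P (inter s (fun j => ~` pat (base z j))) ((1 - pattern_prob) ^+ size s).
Proof.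
move=> us; exists (inter s (fun j => ~` pat (base z j))); split=> //.
  by apply: inter_measurable => j; apply/measurableC/pattern_measurable.
have := @inter_compl _ _ _ P _ (fun j => pat (base z j)) (fun=> pattern_prob) [::] s
  (fun j => pattern_measurable _) (fun s => @pattern_joint z s).
rewrite cats0 inter_nil setTI big_nil mul1r => -> //.
by rewrite big_const_seq count_predT iter_mulr_1.
Qed.

Lemma bad_blocks_bound m N : pbound P (bad_blocks m N)
  ((2 * (2 * N + 1) ^ d)%N%:R * (1 - pattern_prob) ^+ m).
Proof.
apply: (pboundS (@subset_refl _ _) _ (pbound_exists (fun z _ =>
  pboundU (no_pattern_bound z (iota_uniq _ _)) (no_pattern_bound z (iota_uniq _ _))))).
rewrite big_const_seq count_predT iter_addr_0 -[X in X <= _]mulr_natr !size_iota.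
rewrite size_nbr -mul2n -addn1 natrM le_eqVlt; apply/orP; left; apply/eqP; ring.
Qed.

End ManyBlocks.

(** * Almost sure conclusion *)

Definition polyb (f : nat -> nat) :=
  exists C a, forall m, (0 < m)%N -> (f m <= C * m ^ a)%N.

Lemma polyb_cst c : polyb (fun=> c).
Proof. by exists c, 0%N => m _; rewrite muln1. Qed.

Lemma polyb_id : polyb id.
Proof. by exists 1%N, 1%N => m _; rewrite mul1n expn1. Qed.

Lemma polybD f g : polyb f -> polyb g -> polyb (fun m => f m + g m)%N.
Proof.
move=> [C [a hf]] [C' [a' hg]]; exists (C + C')%N, (a + a')%N => m m0.
rewrite mulnDl leq_add //.
  by rewrite (leq_trans (hf m m0)) // leq_mul2l leq_pexp2l ?orbT // leq_addr.
by rewrite (leq_trans (hg m m0)) // leq_mul2l leq_pexp2l ?orbT // leq_addl.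
Qed.

Lemma polybM f g : polyb f -> polyb g -> polyb (fun m => f m * g m)%N.
Proof.
move=> [C [a hf]] [C' [a' hg]]; exists (C * C')%N, (a + a')%N => m m0.
by rewrite (leq_trans (leq_mul (hf m m0) (hg m m0))) // expnD mulnACA.
Qed.

Lemma polybX f n : polyb f -> polyb (fun m => f m ^ n)%N.
Proof.
move=> hf; elim: n => [|n IH]; first exact: polyb_cst.
have [C [a h]] := polybM hf IH.
by exists C, a => m m0; rewrite expnS; exact: h.
Qed.

Lemma polyb_geometric (R : realType) f (r e : R) : polyb f -> 0 <= r < 1 -> 0 < e ->
  exists2 m, (0 < m)%N & (f m)%:R * r ^+ m <= e.
Proof.
move=> [C [a hf]] /andP[r0 r1] e0; pose s := 1 - r.
have s0 : 0 < s by rewrite subr_gt0.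
pose K : R := C%:R * a.+1`!%:R / s ^+ a.+1.
have K0 : 0 <= K by rewrite divr_ge0 ?mulr_ge0 // exprn_ge0 // ltW.
pose m := (Num.Def.archi_bound (K / e)).+1; have m0 : (0 < m)%N by [].
have mR : (0 : R) < m%:R by rewrite ltr0n.
exists m => //.
have rm : r ^+ m <= (expR (s * m%:R))^-1.
  rewrite -expRN -mulNr expRM_natr.
  by rewrite lerXn2r ?nnegrE ?expR_ge0 //; have := expR_ge1Dx (- s); rewrite /s; lra.
have ex : (s * m%:R) ^+ a.+1 / a.+1`!%:R <= expR (s * m%:R).
  by have := expR_ge1Dxn a (mulr_ge0 (ltW s0) (ltW mR)); lra.
have sm : 0 < (s * m%:R) ^+ a.+1 / a.+1`!%:R.
  by rewrite divr_gt0 ?exprn_gt0 ?mulr_gt0 // ltr0n fact_gt0.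
apply: (@le_trans _ _ (K / m%:R)); last first.
  rewrite ler_pdivrMr // [X in _ <= X]mulrC -ler_pdivrMr //.
  have Ke : 0 <= K / e by rewrite divr_ge0 // ltW.
  by apply: le_trans (ltW (archi_boundP Ke)) _; rewrite ler_nat.
apply: (@le_trans _ _ ((C * m ^ a)%N%:R * ((s * m%:R) ^+ a.+1 / a.+1`!%:R)^-1)).
  apply: ler_pM; rewrite ?exprn_ge0 // ?ler_nat ?hf // (le_trans rm) //.
  by rewrite lef_pV2 ?posrE ?expR_gt0.
rewrite le_eqVlt; apply/orP; left; apply/eqP.
rewrite /K natrM natrX exprMn [m%:R ^+ a.+1]exprS; field.
by rewrite !expf_neq0 ?gt_eqF // ltr0n fact_gt0.
Qed.

Section AlmostSure.
Variables (R : realType) (d' : nat) (d0 : measure_display) (T : measurableType d0).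
Notation d := d'.+1.
Variables (P : probability T R) (lam : R) (Phi : T -> set 'rV[R]_d).
Hypothesis lam0 : 0 < lam.
Hypothesis hP : is_hPPP P lam Phi.
Notation point := 'rV[R]_d.
Variable Z : set point.
Hypothesis Z0 : Z `<=` [set 0].

Lemma scale_ae k (N0 : nat) : P.-negligible [set w | ~ scale (Phi w `|` Z) k N0%:R].
Proof.
pose lamN := Num.Def.archi_bound lam.
have lamN1 : lam <= lamN%:R by apply/ltW/archi_boundP/ltW.
have lamN0 : (0 < lamN)%N by rewrite -(ltr0n R) (lt_le_trans lam0).
pose D := spread d' k.
pose L m := (D * m)%N; pose M m := (2 * L m)%N.
pose G m := (48 * lamN * ((2 * M m + 1) ^ d * (1 + lamN * (2 * M m + 1) ^ d)))%N.
pose n m := ((G m * M m) ^ 2)%N.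
pose N m := (N0 + (4 * (2 * n m + 1) + 8) * L m)%N.
have pL : polyb L by apply: polybM; [exact: polyb_cst|exact: polyb_id].
have pM : polyb M by apply: polybM => //; exact: polyb_cst.
have pM1 : polyb (fun m => (2 * M m + 1) ^ d)%N.
  apply: polybX; apply: polybD; last exact: polyb_cst.
  by apply: polybM => //; exact: polyb_cst.
have pG : polyb G.
  apply: polybM; first exact: polyb_cst.
  apply: polybM => //; apply: polybD; first exact: polyb_cst.
  by apply: polybM => //; exact: polyb_cst.
have pn : polyb n by apply: polybX; apply: polybM.
have pN : polyb N.
  apply: polybD; first exact: polyb_cst.
  apply: polybM => //; apply: polybD; last exact: polyb_cst.
  apply: polybM; first exact: polyb_cst.
  apply: polybD; last exact: polyb_cst.
  by apply: polybM => //; exact: polyb_cst.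
pose f m := ((2 + lamN) * (2 * N m + 1) ^ d)%N.
have pf : polyb f.
  apply: polybM; first exact: polyb_cst.
  apply: polybX; apply: polybD; last exact: polyb_cst.
  by apply: polybM => //; exact: polyb_cst.
pose p := @pattern_prob R d' k lam.
have p0 : 0 < p by exact: pattern_prob_gt0.
have p1 : p <= 1 by exact: pattern_prob_le1 hP.
pose r := Num.max (1 - p) 2^-1.
have rp : 1 - p <= r by rewrite le_max lexx.
have r2 : 2^-1 <= r by rewrite le_max lexx orbT.
have r01 : 0 <= r < 1.
  apply/andP; split; first by apply: le_trans r2; rewrite invr_ge0.
  by rewrite gt_max invf_lt1 // ltr1n andbT; move: p0; lra.
apply: pbound_negligible => e e0; have e20 : 0 < e / 2 by rewrite divr_gt0.
have [m m0 fm] := polyb_geometric pf r01 e20.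
have D0 : (0 < D)%N by [].
have L0 : (0 < L m)%N by rewrite muln_gt0 D0.
have G0 : (0 < G m)%N by rewrite !muln_gt0 lamN0 expn_gt0 addn1.
have small : 8 * ((lam * (6 * (2 * M m + 1) ^ d')%N%:R / (G m)%:R) *
       (1 + lam * ((2 * M m + 1) ^ d)%N%:R)) <= 1.
  set x := ((2 * M m + 1) ^ d)%N; set y := ((2 * M m + 1) ^ d')%N.
  have yx : (y <= x)%N by rewrite leq_pexp2l // addn1.
  rewrite [X in 8 * X]mulrAC mulrA ler_pdivrMr ?ltr0n // mul1r.
  rewrite /G -/x !natrM natrD natrM.
  have yx' : y%:R <= x%:R :> R by rewrite ler_nat.
  have a1 : lam * y%:R <= lamN%:R * x%:R by apply: ler_pM => //; exact: ltW.
  have a2 : 1 + lam * x%:R <= 1 + lamN%:R * x%:R by rewrite lerD2l ler_wpM2r.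
  have a3 : lam * y%:R * (1 + lam * x%:R) <= lamN%:R * x%:R * (1 + lamN%:R * x%:R).
    by apply: ler_pM => //; rewrite ?addr_ge0 // ?mulr_ge0 // ltW.
  rewrite (_ : 8 * _ = 48 * (lam * y%:R * (1 + lam * x%:R))); last by ring.
  rewrite (_ : 48 * _ * _ = 48 * (lamN%:R * x%:R * (1 + lamN%:R * x%:R))); last by ring.
  by rewrite ler_pM2l.
have bU := pboundU (bad_blocks_bound k hP m (N m))
  (long_chain_bound lam0 hP (N m) G0 small e20).
apply: pboundS bU; last first.
  apply: (@le_trans _ _ (e / 2 + (f m)%:R * r ^+ m)); last by move: fm; lra.
  have b1 : (1 - pattern_prob d' k lam) ^+ m <= r ^+ m.
    by rewrite lerXn2r ?nnegrE ?(le_trans _ rp) ?subr_ge0.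
  have b2 : 2^-1 ^+ ((G m * M m) ^ 2) <= r ^+ m.
    apply: (@le_trans _ _ (2^-1 ^+ m)); last by rewrite lerXn2r ?nnegrE ?(le_trans _ r2) ?invr_ge0.
    apply: ler_wiXn2l; rewrite ?invr_ge0 // ?invf_le1 // ?ler1n //.
    have mM : (m <= G m * M m)%N.
      apply: (@leq_trans (L m)); first by rewrite leq_pmull.
      by rewrite /M mulnA leq_pmull // muln_gt0 G0.
    by rewrite (leq_trans mM) // -mulnn leq_pmulr // (leq_trans m0 mM).
  set x := ((2 * N m + 1) ^ d)%N in b1 b2 *.
  have x0 : 0 <= x%:R :> R by [].
  have rm0 : 0 <= r ^+ m by rewrite exprn_ge0 //; case/andP: r01.
  have c1 : (2 * x)%N%:R * (1 - pattern_prob d' k lam) ^+ m <= 2 * x%:R * r ^+ m.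
    by rewrite natrM ler_wpM2l // mulr_ge0.
  have c2 : lam * x%:R * 2^-1 ^+ ((G m * M m) ^ 2) <= lamN%:R * x%:R * r ^+ m.
    apply: ler_pM => //; first by apply: mulr_ge0 => //; exact: ltW.
    by rewrite ler_wpM2r.
  rewrite /f -/x [in X in _ <= X]natrM natrD addrCA lerD2l.
  by rewrite (mulrDl 2) [X in _ <= X]mulrDl lerD.
move=> w /=; apply: contra_notP; rewrite not_orE => -[nb nl].
exists (L m)%:R, (N m)%:R, (n m).*2.+1; split.
- by rewrite ltr0n.
- have -> : (n m).*2.+1 = (2 * n m + 1)%N by lia.
  by rewrite -natrM -natrD -natrM -natrD.
- by move=> c cN; exact: (good_blocks m0 Z0 nb cN).
have -> : 2 * (L m)%:R = (M m)%:R :> R by rewrite /M natrM.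
apply: chain_avoiding_origin => u st ch un sz.
apply: contrapT => /negP n0; apply: nl; exists u, st; split=> //.
apply: (dchain_sub ch) => y yst [//|/Z0 y0].
by rewrite /= in y0; rewrite y0 (negPf n0) in yst.
Qed.

Theorem chn_ae : {ae P, forall w, forall n, chn_wd (Phi w `|` Z) n /\
  good_level (Phi w `|` Z) (chn (Phi w `|` Z) n)}.
Proof.
have neg : P.-negligible ([set w | ~ no_ties (Phi w `|` Z)] `|`
    \bigcup_k \bigcup_N0 [set w | ~ scale (Phi w `|` Z) k N0%:R]).
  apply: negligibleU; first exact: (no_ties_ae lam0 hP Z0).
  by apply: negligible_bigcup => k; apply: negligible_bigcup => N0; exact: scale_ae.
apply: negligibleS neg => w /=; apply: contra_notP.
rewrite not_orE => -[/contrapT ties nsc] n.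
apply: chn_well_defined => //.
  move=> r; rewrite setIUl finite_setU; split.
    exact: (Phi_locally_finite hP).
  by apply: sub_finite_set (finite_set1 0) => x [/Z0].
move=> k N0.
have [L [N [m [L0 LN hb hc]]]] :
    scale (Phi w `|` Z) k (Num.Def.archi_bound `|N0|)%:R.
  by apply: contrapT => ns; apply: nsc; exists k => //; exists (Num.Def.archi_bound `|N0|).
exists L, N, m; split=> //; apply: le_trans LN; rewrite lerD2r.
by apply: le_trans (ler_norm _) (ltW (archi_boundP (normr_ge0 _))).
Qed.

End AlmostSure.

Theorem mainTheorem3 (R : realType) (d : nat) (d0 : measure_display)
  (T : measurableType d0) (P : probability T R) (lam : R)
  (Phi : T -> set 'rV[R]_d) :
  (0 < d)%N -> 0 < lam -> is_hPPP P lam Phi ->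
  {ae P, forall w, forall n, chn_wd (Phi w) n} /\
  {ae P, forall w, forall n,
     chn_wd (Phi w `|` [set 0]) n /\
     good_level (Phi w `|` [set 0]) (chn (Phi w `|` [set 0]) n)}.
Proof.
case: d Phi => [//|d'] Phi _ lam0 hP; split; last exact: (chn_ae lam0 hP).
have := chn_ae lam0 hP (@sub0set _ [set 0]); apply: filterS => w h n.
by have [] := h n; rewrite setU0.
Qed.
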